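(* Consider drone base stations (DBSs) in the plane $z=h$ ($h>0$) whose positions at time $0$ form a homogeneous Poisson point process of density $\lambda_0>0$. Each DBS moves, independently of the others, along a straight line in a uniformly random direction in that plane with a constant speed, the speeds being i.i.d. copies of a non-negative random variable $V$ with cdf $F_V$ and pdf $f_V$, independent of directions and initial positions (different speed model). A static typical UE at the origin $\mathbf{o}=(0,0,0)$ is at each time served by its nearest DBS. Then for every $t>0$ the handover probability satisfies $$\mathbb{P}[H(t)]\ \ge\ 1-\frac{1}{2\pi}\int_0^\infty\!\!\int_0^\infty\!\!\int_0^{2\pi} 2\pi\lambda_0u^*e^{-\lambda_0\pi {u^*}^2}f_V(v)\exp\!\left[-\int_0^R 2\pi u_{\mathbf{x}}\,\lambda(t;u_{\mathbf{x}},u^* )\,\mathrm{d}u_{\mathbf{x}}\right]\mathrm{d}\theta\,\mathrm{d}u^*\,\mathrm{d}v,$$ where $R=\sqrt{{u^*}^2+v^2t^2-2u^*vt\cos\theta}$ and $$\lambda(t;u_{\mathbf{x}},u^* )=\lambda_0\left[1-F_V\!\left(\frac{u^*-u_{\mathbf{x}}}{t}\right)-\int_{\frac{|u^*-u_{\mathbf{x}}|}{t}}^{\frac{u^*+u_{\mathbf{x}}}{t}} f_V(w)\,\frac{1}{\pi}\cos^{-1}\!\left(\frac{w^2t^2+u_{\mathbf{x}}^2-{u^*}^2}{2wtu_{\mathbf{x}}}\right)\mathrm{d}w\right].$$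
   Context: Let $\mathbf{x}_i(s)$, $i\in\mathbb{N}$, denote the DBS positions at time $s$ (arbitrary fixed indexing). The handover event by time $t$ is $H(t)=\{\exists s<t:\ \arg\min_{i\in\mathbb{N}}\|\mathbf{x}_i(s)\|\neq\arg\min_{i\in\mathbb{N}}\|\mathbf{x}_i(t)\|\}$, and $\mathbb{P}[H(t)]$ is the handover probability (probability that the first change of serving DBS occurs at or before $t$). In the formula, $u^*$ plays the role of the initial distance from $\mathbf{o}'=(0,0,h)$ to the nearest DBS, $v$ the speed and $\theta$ the direction of the initially serving DBS. *)

(* Defs.v *)
From HB Require Import structures.
From mathcomp Require Import all_boot all_order all_algebra.
From mathcomp Require Import all_classical all_reals all_analysis.
Set Implicit Arguments. Unset Strict Implicit. Unset Printing Implicit Defensive.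
Import Order.TTheory GRing.Theory Num.Theory.
Local Open Scope classical_set_scope.
Local Open Scope ring_scope.

Section Defs.
Variable R : realType.

Notation leb := (@lebesgue_measure R).

(* Half-open boxes ]x1,x2] x ]y1,y2] x ]v1,v2] x ]t1,t2] in the mark space
   (initial horizontal position, speed, direction). *)
Record box := Box { bx1 : R; bx2 : R; by1 : R; by2 : R;
                    bv1 : R; bv2 : R; bt1 : R; bt2 : R }.

Definition box_ok (B : box) : Prop :=
  bx1 B <= bx2 B /\ by1 B <= by2 B /\ bv1 B <= bv2 B /\ bt1 B <= bt2 B.

Definition in_box (B : box) (x y v th : R) : Prop :=
  x \in `]bx1 B, bx2 B] /\ y \in `]by1 B, by2 B] /\
  v \in `]bv1 B, bv2 B] /\ th \in `]bt1 B, bt2 B].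

(* Intensity measure of a box: lam0 * Leb2 (position part)
   * P[V in ]v1,v2]] * (uniform law on [0,2pi) of ]t1,t2]). *)
Definition box_intensity (lam0 : R) (FV : R -> R) (B : box) : R :=
  lam0 * (bx2 B - bx1 B) * (by2 B - by1 B) * (FV (bv2 B) - FV (bv1 B)) *
  (Num.max 0 (Num.min (bt2 B) (2 * pi) - Num.max (bt1 B) 0) / (2 * pi)).

Definition poisson_pmf (m : R) (n : nat) : R := expR (- m) * m ^+ n / n`!%:R.

Section Process.
Context d (Omega : measurableType d).
Variables (px py v th : nat -> Omega -> R).

Definition count_eq (B : box) (n : nat) : set Omega :=
  [set w | exists s : seq nat, uniq s /\ size s = n /\
     forall i, in_box B (px i w) (py i w) (v i w) (th i w) <-> i \in s].

(* The marked point process {(x_i(0), v_i, theta_i)} is a Poisson point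
   process on R^2 x R x R with intensity
   lam0 dx dy (x) f_V(v) dv (x) 1_[0,2pi)(theta) dtheta/(2pi):
   counts in finitely many pairwise-disjoint boxes are independent Poisson. *)
Definition marked_PPP (P : probability Omega R) (lam0 : R) (FV : R -> R) :=
  forall (k : nat) (B : 'I_k -> box) (n : 'I_k -> nat),
    (forall j, box_ok (B j)) ->
    (forall j j', j != j' -> forall x y v0 t0,
        in_box (B j) x y v0 t0 -> ~ in_box (B j') x y v0 t0) ->
    P (\bigcap_(j in [set: 'I_k]) count_eq (B j) (n j)) =
    (\prod_(j < k) poisson_pmf (box_intensity lam0 FV (B j)) (n j))%:E.

Definition dist_o (h : R) (s : R) (i : nat) (w : Omega) : R :=
  Num.sqrt ((px i w + s * v i w * cos (th i w)) ^+ 2 +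
            (py i w + s * v i w * sin (th i w)) ^+ 2 + h ^+ 2).

Definition nearest (h s : R) (i : nat) (w : Omega) : Prop :=
  forall j, dist_o h s i w <= dist_o h s j w.

Definition handover (h t : R) : set Omega :=
  [set w | exists s, 0 <= s < t /\ exists i j,
     nearest h s i w /\ nearest h t j w /\ i <> j].
End Process.

Definition lam_thin (lam0 : R) (FV fV : R -> R) (t ux us : R) : R :=
  lam0 * (1 - FV ((us - ux) / t) -
   (\int[leb]_(w in `[ `|us - ux| / t, (us + ux) / t]%classic)
      (fV w * (pi^-1 * acos ((w ^+ 2 * t ^+ 2 + ux ^+ 2 - us ^+ 2)
                              / (2 * w * t * ux)))))%R).

Definition lb_integrand (lam0 : R) (FV fV : R -> R) (t vv us theta : R) : R :=
  let Rr := Num.sqrt (us ^+ 2 + vv ^+ 2 * t ^+ 2 - 2 * us * vv * t * cos theta) in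
  2 * pi * lam0 * us * expR (- (lam0 * pi * us ^+ 2)) * fV vv *
  expR (- (\int[leb]_(ux in `[0, Rr]%classic)
             (2 * pi * ux * lam_thin lam0 FV fV t ux us))%R).

Definition handover_lower_bound (lam0 : R) (FV fV : R -> R) (t : R) : \bar R :=
  adde 1%:E (oppe (mule ((2 * pi)^-1)%:E
    (\int[leb]_(vv in `[0%R, +oo[%classic)
      \int[leb]_(us in `[0%R, +oo[%classic)
        \int[leb]_(theta in `[0%R, (2 * pi)%R]%classic)
          (lb_integrand lam0 FV fV t vv us theta)%:E)%E)).

End Defs.

(* Main.v *)
(* The event that one station is nearest at time 0 and another one at time t is
   measurable and contained in H(t).  Up to null sets its complement is the event
   that a single station is nearest at both times.  Cut the space of marks (speed,
   initial position, direction) into small cells.  If that station has its mark in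
   a cell c, then the Poisson process hits c and misses every cell all of whose
   marks beat those of c at time 0 or at time t; by independence this has
   probability at most L(c) exp(-L(union of the beating cells)), L being the
   intensity measure.  Summing over c and refining the grid (Fatou) bounds the
   probability of the complement by the integral of exp(-L(region m)) against
   L(dm), where region m is the set of marks beating m.

   If m starts at distance u and ends at distance r, then L(region m) is the mass
   lam0 pi u^2 of the disk at time 0, plus the mass of the stations that start
   outside that disk and end within distance r.  Translating along the velocities
   and averaging over the directions turns the latter into the integral of
   2 pi s lambda(t; s, u) over [0, r].  Polar coordinates then give the formula.

   A nearest station exists almost surely at a fixed time, because the mean number
   of stations in a disk is finite (Borel-Cantelli). *)
Require Import Defs.
From HB Require Import structures.
From mathcomp Require Import all_boot all_order all_algebra.
From mathcomp Require Import all_classical all_reals all_analysis.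
From mathcomp Require Import measurable_realfun ring lra.
Set Implicit Arguments. Unset Strict Implicit. Unset Printing Implicit Defensive.
Import Order.TTheory GRing.Theory Num.Theory.
Import numFieldNormedType.Exports.
Local Open Scope classical_set_scope.
Local Open Scope ring_scope.

(** * Integration against densities, translations and polar coordinates *)

(** For a Poisson process Mecke's formula would give the mean number of unbeaten stations as exactly
    the integral of [exp (- L (region m))]. The hypothesis speaks only of counts in finitely many
    disjoint boxes, so just the inequality that is wanted gets derived, from void probabilities
    alone: the event that [c] is hit while [A] is empty has probability
    [exp (- L A) - exp (- L (c + A))], at most [L c * exp (- L A)]. Beating is defined by strict
    inequalities, hence an open relation; this is why cells that beat one another as a whole exhaust
    the true region in the limit. Since Fatou bounds limits from below and an upper bound is sought,
    it is applied to a complement, which requires finite mass: the server's mark is first confined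
    to a bounded cube, and the cube grows at the end. The event H(t) quantifies over uncountably
    many times. The probability bound is therefore carried by a measurable subset that looks at the
    times 0 and [t] only. *)

Section density.
Import HBNNSimple.
Context d (T : measurableType d) (R : realType).
Variables (mu nu : {measure set T -> \bar R}) (f : T -> R).
Hypotheses (mf : measurable_fun setT f) (f0 : forall x, 0 <= f x).
Hypothesis nuE : forall A, measurable A -> nu A = (\int[mu]_(x in A) (f x)%:E)%E.

Let mfE : measurable_fun setT (EFin \o f).
Proof. exact/measurable_EFinP. Qed.

Let integral_density_indic E : measurable E ->
  (\int[nu]_x (\1_E x)%:E = \int[mu]_x ((f x)%:E * (\1_E x)%:E))%E.
Proof.
move=> mE; rewrite integral_indic// setIT nuE// integral_mkcond.
apply: eq_integral => x _; rewrite patchE indicE; case: (x \in E).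
  by rewrite mule1.
by rewrite mule0.
Qed.

Let integral_density_nnsfun (h : {nnsfun T >-> R}) :
  (\int[nu]_x (h x)%:E = \int[mu]_x ((f x)%:E * (h x)%:E))%E.
Proof.
under [LHS]eq_integral do rewrite fimfunE -fsumEFin//.
rewrite [LHS]ge0_integral_fsum//; last 2 first.
  - by move=> r; exact/measurable_EFinP/measurableT_comp.
  - by move=> n x _; rewrite EFinM nnfun_muleindic_ge0.
under [RHS]eq_integral.
  move=> x _; rewrite fimfunE -fsumEFin// ge0_mule_fsumr; last first.
    by move=> r; rewrite EFinM nnfun_muleindic_ge0.
  over.
rewrite [RHS]ge0_integral_fsum//; last 2 first.
  - move=> r; apply: emeasurable_funM => //.
    exact/measurable_EFinP/measurableT_comp.
  - move=> n x _; apply: mule_ge0; first by rewrite lee_fin.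
    by rewrite EFinM nnfun_muleindic_ge0.
apply: eq_fsbigr => r _.
under [RHS]eq_integral do rewrite EFinM muleCA.
rewrite integralZl_indic_nnsfun//= integral_density_indic//.
have [r0|r0] := ltP r 0.
  rewrite (_ : h @^-1` [set r] = set0); last first.
    apply/seteqP; split => // x /= hx; move: r0; rewrite -hx ltNge.
    by rewrite fun_ge0.
  by rewrite !integral0_eq ?mule0// => x _; rewrite indic0 ?mule0.
rewrite ge0_integralZl//.
- apply: emeasurable_funM => //; apply/measurable_EFinP/measurable_indic.
  exact: measurable_sfunP.
- by move=> x _; rewrite mule_ge0// lee_fin.
Qed.

(** Holds for indicators by [nuE], for simple functions by linearity, and in general by monotone
    convergence; neither measure has to be sigma-finite. *)
Lemma ge0_integral_density (g : T -> \bar R) :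
  measurable_fun setT g -> (forall x, 0 <= g x)%E ->
  (\int[nu]_x g x = \int[mu]_x ((f x)%:E * g x))%E.
Proof.
move=> mg g0; pose g_ := nnsfun_approx measurableT mg.
have cg x : (g_ n x)%:E @[n --> \oo] --> g x by exact: cvg_nnsfun_approx.
transitivity (lim ((\int[nu]_x (g_ n x)%:E) @[n --> \oo])%E).
  rewrite -monotone_convergence//=.
  - by apply: eq_integral => x _; apply/esym/cvg_lim.
  - by move=> n; exact/measurable_EFinP/measurable_funTS.
  - by move=> n ? _; rewrite lee_fin.
  - by move=> ? _ ? ? mn; rewrite lee_fin; exact/lefP/nd_nnsfun_approx.
transitivity (lim ((\int[mu]_x ((f x)%:E * (g_ n x)%:E)) @[n --> \oo])%E).
  by apply: congr_lim; apply/funext => n; exact: integral_density_nnsfun.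
rewrite -monotone_convergence//=.
- apply: eq_integral => x _; apply/cvg_lim => //.
  by apply: cvgeZl => //.
- move=> n; apply: emeasurable_funM => //.
  exact/measurable_EFinP/measurable_funTS.
- by move=> n ? _; rewrite mule_ge0// lee_fin.
- move=> x _ ? ? mn; rewrite lee_wpmul2l// lee_fin//.
  exact/lefP/nd_nnsfun_approx.
Qed.
End density.

Section shift.
Variable R : realType.
Local Notation leb := (@lebesgue_measure R).

Lemma lebesgue_measure_shift (c : R) (A : set R) : measurable A ->
  pushforward leb (fun x : measurableTypeR R => (x + c)%R : measurableTypeR R) A = leb A.
Proof.
have mc : measurable_fun setT (fun x : measurableTypeR R => (x + c)%R : measurableTypeR R).
  exact: measurable_funD.
pose mc_mixin := isMeasurableFun.Build _ _ _ _ _ mc.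
move=> mA; apply/esym/lebesgue_measure_unique => //= _ [[a b]] _ <-.
rewrite /pushforward (_ : _ @^-1` _ = `]a - c, b - c]%classic); last first.
  apply/seteqP; split => x /=; rewrite !in_itv/= => /andP[? ?]; apply/andP; lra.
rewrite !lebesgue_measure_itv/= !lte_fin ltrD2r.
by case: ifPn => // _; rewrite -!EFinB; congr EFin; ring.
Qed.

Lemma ge0_integral_shift (c : R) (f : R -> \bar R) :
  measurable_fun setT f -> (forall x, 0 <= f x)%E ->
  (\int[leb]_x f (x + c)%R = \int[leb]_x f x)%E.
Proof.
move=> mf f0.
have mc : measurable_fun setT (fun x : measurableTypeR R => (x + c)%R : measurableTypeR R).
  exact: measurable_funD.
rewrite -[LHS](@ge0_integral_pushforward _ _ (measurableTypeR R) (measurableTypeR R) R _ mc leb setT f)//.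
by apply: eq_measure_integral => //= A mA _; exact: lebesgue_measure_shift.
Qed.

Lemma ge0_integral_shift_itv (a b c : R) (f : R -> \bar R) :
  measurable_fun setT f -> (forall x, 0 <= f x)%E ->
  (\int[leb]_(x in `[a, b]) f (x + c)%R = \int[leb]_(x in `[(a + c)%R, (b + c)%R]) f x)%E.
Proof.
move=> mf f0; rewrite integral_mkcond [RHS]integral_mkcond.
rewrite -(ge0_integral_shift c (f := f \_ _)).
- apply: eq_integral => x _; rewrite !patchE.
  by rewrite !(mem_setE, in_itv)/= !lerD2r.
- apply: (measurable_restrictT _ _).1 => //.
  exact: measurable_funTS.
- by move=> x; rewrite patchE; case: ifP.
Qed.

(** The shifted window [[c, p + c]] is cut at [p]; by periodicity the overhang [[p, p + c]] weighs
    as much as the missing [[0, c]]. *)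
Lemma ge0_integral_periodic (p : R) (f : R -> \bar R) : 
  measurable_fun setT f -> (forall x, 0 <= f x)%E -> (forall x, f (x + p)%R = f x) ->
  forall c, 0 <= c <= p ->
  (\int[leb]_(x in `[0%R, p]) f (x + c)%R = \int[leb]_(x in `[0%R, p]) f x)%E.
Proof.
move=> mf f0 fp c /andP[c0 cp]; rewrite ge0_integral_shift_itv// add0r.
have split3 (a b d : R) : a <= b <= d ->
   (\int[leb]_(x in `[a, d]) f x = \int[leb]_(x in `[a, b]) f x + \int[leb]_(x in `[b, d]) f x)%E.
  move=> /andP[ab bd]; rewrite (@itv_bndbnd_setU _ _ _ (BRight b))//.
  rewrite ge0_integral_setU//=; last 2 first.
    exact: measurable_funTS.
    apply/disj_setPRL => x/=; rewrite !in_itv/= => /andP[bx _] /andP[_].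
    by rewrite leNgt bx.
  by congr (_ + _)%E; rewrite integral_itv_obnd_cbnd//; exact: measurable_funTS.
rewrite (split3 _ p); last by apply/andP; lra.
rewrite (split3 0 c p); last by apply/andP; lra.
rewrite addeC; congr (_ + _)%E.
have := @ge0_integral_shift_itv 0 c p f mf f0; rewrite add0r addrC => <-.
by apply: eq_integral => x _; rewrite fp.
Qed.
End shift.

Section disk.
Variable R : realType.
Local Notation leb := (@lebesgue_measure R).
Local Notation leb2 := (leb \x leb)%E.

(** No sign condition on [c]: [Num.sqrt] is 0 on negative reals, which matches the empty set. The
    sections of a disk can thus be integrated over all abscissae. *)
Lemma lebesgue_measure_sqr_lt (c : R) :
  leb [set y : measurableTypeR R | y ^+ 2 < c] = (2 * Num.sqrt c)%:E.
Proof.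
have [c0|c0] := ltP 0 c.
  rewrite (_ : [set y | _] = `]- Num.sqrt c, Num.sqrt c[%classic).
    rewrite lebesgue_measure_itv/= lte_fin gtrN ?sqrtr_gt0//.
    by rewrite -EFinD; congr EFin; ring.
  apply/seteqP; split => y /=; rewrite in_itv/= -ltr_norml.
    by move=> yc; rewrite -sqrtr_sqr ltr_sqrt.
  move=> yc; rewrite -(sqr_sqrtr (ltW c0)) -real_normK ?num_real//.
  by rewrite ltrXn2r// nnegrE.
rewrite (_ : [set y | _] = set0) ?measure0 ?ler0_sqrtr ?mulr0//.
by apply/seteqP; split => // y /= yc; have := sqr_ge0 y; lra.
Qed.

Lemma continuous_halfcircle (b : R) : continuous (fun x : R => 2 * Num.sqrt (b ^+ 2 - x ^+ 2)).
Proof.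
move=> x; apply: cvgM; first exact: cvg_cst.
apply: (@continuous_comp _ _ _ (fun x : R => b ^+ 2 - x ^+ 2) Num.sqrt); last exact: sqrt_continuous.
apply: cvgB; first exact: cvg_cst.
exact: exprn_continuous.
Qed.

Lemma integral_halfcircle (b : R) : 0 < b ->
  (\int[leb]_(x in `[(- b)%R, b]) (2 * Num.sqrt (b ^+ 2 - x ^+ 2))%:E = (pi * b ^+ 2)%:E)%E.
Proof.
move=> b0; have p0 : 0 < pi / 2 :> R by rewrite divr_gt0// pi_gt0.
(* Substitute [x = b sin phi], so that the derivative stays bounded at the endpoints. *)
pose F (x : R) := b * sin x.
have dF (x : R) : is_derive x 1 F (b * cos x).
  rewrite /F; apply: is_derive_eq; rewrite /GRing.scale/=; ring.
have F'E : derive1 F = fun x => b * cos x by apply/funext => x; rewrite derive1E; exact: derive_val.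
have cF : continuous F.
  by move=> x; apply: cvgM; [exact: cvg_cst|exact: continuous_sin].
have cbcos : continuous (fun x : R => b * cos x).
  by move=> x; apply: cvgM; [exact: cvg_cst|exact: continuous_cos].
have -> : `[- b, b]%classic = `[F (- (pi / 2)), F (pi / 2)]%classic.
  by rewrite /F sinN sin_pihalf mulrN mulr1.
rewrite integration_by_substitution_increasing; last 7 first.
- lra.
- by move=> x y xp yp xy; rewrite /F ltr_pM2l// ltr_sin.
- by move=> x _; rewrite F'E; exact: cbcos.
- by rewrite F'E; apply/cvg_ex; eexists; apply: cvg_at_right_filter; exact: cbcos.
- by rewrite F'E; apply/cvg_ex; eexists; apply: cvg_at_left_filter; exact: cbcos.
- split.
  + by move=> x _; exact: ex_derive.
  + by apply: cvg_at_right_filter; exact: cF.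
  + by apply: cvg_at_left_filter; exact: cF.
- by apply: continuous_subspaceT; exact: continuous_halfcircle.
pose g (x : R) := 2 * b ^+ 2 * cos x ^+ 2.
transitivity (\int[leb]_(x in `[(- (pi / 2))%R, (pi / 2)%R]) (g x)%:E)%E.
  apply: eq_integral => x; rewrite inE/= in_itv/= => xp.
  congr EFin; rewrite F'E.
  change (2 * Num.sqrt (b ^+ 2 - (b * sin x) ^+ 2) * (b * cos x) = 2 * b ^+ 2 * cos x ^+ 2).
  have -> : b ^+ 2 - (b * sin x) ^+ 2 = (b * cos x) ^+ 2.
    by rewrite !exprMn sin2cos2; ring.
  rewrite sqrtr_sqr ger0_norm; last by rewrite mulr_ge0 ?cos_ge0_pihalf// ltW.
  ring.
pose G (x : R) := b ^+ 2 * (x + sin x * cos x).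
have dG (x : R) : is_derive x 1 G (g x).
  rewrite /G; apply: is_derive_eq; rewrite /GRing.scale/= /g.
  have := cos2Dsin2 x; nra.
have cG : continuous G.
  move=> x; apply: differentiable_continuous; apply/derivable1_diffP.
  exact: ex_derive.
rewrite (@continuous_FTC2 _ g G).
- by rewrite -EFinB /G sinN cosN cos_pihalf; congr EFin; field.
- lra.
- apply: continuous_subspaceT => x; apply: cvgM; first exact: cvg_cst.
  apply: (@continuous_comp _ _ _ (@cos R) (fun x => x ^+ 2)); first exact: continuous_cos.
  exact: exprn_continuous.
- split.
  + by move=> x _; exact: ex_derive.
  + by apply: cvg_at_right_filter; exact: cG.
  + by apply: cvg_at_left_filter; exact: cG.
- by move=> x _; rewrite derive1E; exact: derive_val.
Qed.

(** The Euclidean norm; the norm that the product type carries is the maximum norm. *)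
Definition enorm (z : R * R) : R := Num.sqrt (z.1 ^+ 2 + z.2 ^+ 2).

Lemma measurable_enorm : measurable_fun setT enorm.
Proof.
have mN : measurable_fun setT (fun z : R * R => z.1 ^+ 2 + z.2 ^+ 2).
  by apply: measurable_funD; apply: measurable_funX;
    [exact: measurable_fst|exact: measurable_snd].
have ms : measurable_fun setT (@Num.sqrt R).
  by apply: continuous_measurable_fun; exact: sqrt_continuous.
exact: (measurableT_comp ms mN).
Qed.

Lemma disk_area (b : R) : 0 <= b -> leb2 [set z | enorm z < b] = (pi * b ^+ 2)%:E.
Proof.
move=> b0; rewrite /product_measure1.
transitivity (\int[leb]_x (2 * Num.sqrt (b ^+ 2 - x ^+ 2))%:E)%E.
  apply: eq_integral => x _ /=; rewrite -lebesgue_measure_sqr_lt; congr leb.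
  rewrite /xsection; apply/seteqP; split => y /=; rewrite inE/= /enorm/=.
    move=> h; rewrite ltrBrDl -(sqr_sqrtr (_ : 0 <= x ^+ 2 + y ^+ 2)) ?addr_ge0 ?sqr_ge0//.
    by rewrite ltrXn2r// nnegrE sqrtr_ge0.
  rewrite ltrBrDl => h; rewrite -(ger0_norm b0) -sqrtr_sqr ltr_sqrt//.
  by rewrite (le_lt_trans _ h)// addr_ge0 ?sqr_ge0.
transitivity (\int[leb]_(x in `[(-b)%R, b]) (2 * Num.sqrt (b ^+ 2 - x ^+ 2))%:E)%E.
  rewrite [RHS]integral_mkcond; apply: eq_integral => x _; rewrite patchE.
  case: ifPn => //; rewrite mem_setE in_itv/= -ler_norml -ltNge => bx.
  rewrite ltr0_sqrtr ?mulr0// subr_lt0 -(real_normK (num_real x)).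
  by rewrite ltrXn2r// nnegrE.
move: b0; rewrite le_eqVlt => /predU1P[<-|]; last exact: integral_halfcircle.
by rewrite oppr0 set_itv1 integral_set1 expr0n/= mulr0.
Qed.
End disk.

Section dens.
Context d (T : measurableType d) (R : realType) (mu : {measure set T -> \bar R}) (f : T -> R).

(** The proofs [f0] and [mf] are arguments so that the measure structure can be attached to the term
    itself. *)
Definition dens (f0 : forall x, 0 <= f x) (mf : measurable_fun setT f)
  : set T -> \bar R := fun A => (\int[mu]_(x in A) (f x)%:E)%E.

Hypotheses (f0 : forall x, 0 <= f x) (mf : measurable_fun setT f).

Let dens0 : dens f0 mf set0 = 0%E.
Proof. by rewrite /dens integral_set0. Qed.

Let dens_ge0 A : (0 <= dens f0 mf A)%E.
Proof. by apply: integral_ge0 => x _; rewrite lee_fin. Qed.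

Let dens_sigma_additive : semi_sigma_additive (dens f0 mf).
Proof.
move=> /= F mF tF mUF; rewrite /dens; apply: cvg_toP.
  apply: ereal_nondecreasing_is_cvgn => m n mn.
  apply: lee_sum_nneg_natr => // k _ _.
  by apply: integral_ge0 => /= x _; rewrite lee_fin.
rewrite ge0_integral_bigcup//=.
- by apply: measurable_funTS; apply/measurable_EFinP.
- by move=> x _; rewrite lee_fin.
Qed.

HB.instance Definition _ := isMeasure.Build _ _ _ (dens f0 mf)
  dens0 dens_ge0 dens_sigma_additive.

Lemma ge0_integral_dens (g : T -> \bar R) :
  measurable_fun setT g -> (forall x, 0 <= g x)%E ->
  (\int[dens f0 mf]_x g x = \int[mu]_x ((f x)%:E * g x))%E.
Proof. by move=> mg g0; apply: ge0_integral_density. Qed.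
End dens.

Section polar.
Variable R : realType.
Local Notation leb := (@lebesgue_measure R).
Local Notation leb2 := (leb \x leb)%E.

(** Radial density of plane Lebesgue measure. The maximum makes it nonnegative on the whole line, as
    [dens] requires. *)
Let w (u : measurableTypeR R) : R := 2 * pi * Num.max u 0.

Let w0 u : 0 <= w u.
Proof. by rewrite /w mulr_ge0 ?mulr_ge0 ?pi_ge0// le_max lexx orbT. Qed.

Let mw : measurable_fun setT w.
Proof. by apply: measurable_funM => //; apply: measurable_maxr. Qed.

Let dens_w_itv (b : R) : dens leb w0 mw `]-oo, b[ = (pi * (Num.max b 0) ^+ 2)%:E.
Proof.
have E0 : forall A : set R, A `<=` [set x | x <= 0] ->
    (\int[leb]_(x in A) (w x)%:E = 0)%E.
  move=> A A0; apply: integral0_eq => x /A0 /= x0.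
  by rewrite /w (max_idPr x0) mulr0.
rewrite /dens; have [b0|b0] := leP b 0.
  rewrite E0; first by rewrite expr0n/= mulr0.
  by move=> x /=; rewrite in_itv/= => xb; rewrite (le_trans _ b0)// ltW.
rewrite (@itv_bndbnd_setU _ _ _ (BLeft 0)) ?bnd_simp ?(ltW b0)//.
have mwE : measurable_fun setT (EFin \o w) by apply/measurable_EFinP.
rewrite ge0_integral_setU//=; last 3 first.
  exact: measurable_funTS.
  by move=> x _; rewrite lee_fin.
  by apply/disj_setPRL => x/=; rewrite !in_itv/= => /andP[bx _]; apply/negP; rewrite -leNgt.
rewrite E0 ?add0e; last by move=> x /=; rewrite in_itv/= => /ltW.
rewrite integral_itv_bndo_bndc; last exact: measurable_funTS.
transitivity (\int[leb]_(x in `[0%R, b]) (2 * pi * x)%:E)%E.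
  apply: eq_integral => x; rewrite inE/= in_itv/= => /andP[x0 _].
  by rewrite /w (max_idPl x0).
pose G (x : R) := pi * (x ^+ 2).
have dG (x : R) : is_derive x 1 G (2 * pi * x).
  rewrite /G; apply: is_derive_eq; rewrite /GRing.scale/=; ring.
have cG : continuous G.
  move=> x; apply: differentiable_continuous; apply/derivable1_diffP.
  exact: ex_derive.
rewrite (@continuous_FTC2 _ _ G).
- by rewrite -EFinB /G expr0n/= mulr0 subr0.
- by [].
- apply: continuous_subspaceT => x; apply: cvgM; first exact: cvg_cst.
  exact: cvg_id.
- split.
  + by move=> x _; exact: ex_derive.
  + by apply: cvg_at_right_filter; exact: cG.
  + by apply: cvg_at_left_filter; exact: cG.
- by move=> x _; rewrite derive1E; exact: derive_val.
Qed.

Let me : measurable_fun setT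
  (@enorm R : measurableTypeR R * measurableTypeR R -> measurableTypeR R).
Proof. exact: measurable_enorm. Qed.

Let me_mixin := isMeasurableFun.Build _ _ _ _ _ me.
Let me_mfun : {mfun (measurableTypeR R * measurableTypeR R)%type >-> measurableTypeR R} :=
  HB.pack (@enorm R : (measurableTypeR R * measurableTypeR R)%type -> measurableTypeR R) me_mixin.

(** For radial integrands polar coordinates amount to this identity of measures on the line. The
    rays []-oo, b[] are stable under intersection and generate the Borel sets, so it suffices that
    the disk area [pi * b ^+ 2] is the integral of [2 * pi * u] up to [b]. *)
Let pushforward_enormE (A : set (measurableTypeR R)) : measurable A ->
  pushforward leb2 (@enorm R : _ -> measurableTypeR R) A = dens leb w0 mw A.
Proof.
have hitv (b : R) : pushforward leb2 (@enorm R) `]-oo, b[ = (pi * (Num.max b 0) ^+ 2)%:E.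
  rewrite /pushforward; have [b0|b0] := leP b 0.
    rewrite (_ : _ @^-1` _ = set0) ?measure0 ?expr0n/= ?mulr0//.
    apply/seteqP; split => // z /=; rewrite in_itv/= => zb.
    by have := sqrtr_ge0 (z.1 ^+ 2 + z.2 ^+ 2); rewrite -/(enorm z); lra.
  rewrite (_ : _ @^-1` _ = [set z | enorm z < b]); first exact/disk_area/ltW.
  by apply/seteqP; split => z /=; rewrite in_itv.
move=> mA.
apply: (@measure_unique _ _ (measurableTypeR R) (@RGenInftyO.G R) (fun n => `]-oo, n%:R[%classic) _ _ _ _
   (pushforward leb2 (me_mfun : _ -> _)) (dens leb w0 mw)) => //.
- exact: RGenInftyO.measurableE.
- move=> _ _ [a ->] [b ->]; exists (Num.min a b); apply/seteqP; split => x /=.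
    by rewrite !in_itv/= lt_min => -[-> ->].
  by rewrite !in_itv/= lt_min => /andP[].
- by move=> n; exists n%:R.
- apply/seteqP; split => // x _; exists (Num.bound `|x|) => //=.
  by rewrite in_itv/= (le_lt_trans (ler_norm x))// archi_boundP.
- by move=> _ [b ->]; exact: (etrans (hitv b) (esym (dens_w_itv b))).
- by move=> n; rewrite [X in (X < _)%E]hitv ltry.
Qed.

Lemma ge0_integral_polar (g : R -> \bar R) :
  measurable_fun setT g -> (forall u, 0 <= g u)%E ->
  (\int[leb2]_z g (enorm z) =
   \int[leb]_(u in `[0%R, +oo[) ((2 * pi * u)%:E * g u))%E.
Proof.
move=> mg g0.
transitivity (\int[dens leb w0 mw]_u g u)%E.
  rewrite -[LHS](@ge0_integral_pushforward _ _ (measurableTypeR R * measurableTypeR R)%type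
    (measurableTypeR R) R _ me leb2 setT g)//.
  by apply: eq_measure_integral => //= A mA _; exact: pushforward_enormE.
rewrite ge0_integral_dens// [RHS]integral_mkcond; apply: eq_integral => u _.
rewrite patchE mem_setE in_itv/= andbT /w; have [//|_] := leP 0 u.
by rewrite mulr0 mul0e.
Qed.
End polar.

Section circle.
Variable R : realType.
Local Notation leb := (@lebesgue_measure R).

(** [acos] serves the upper half plane and [2 * pi - acos] the lower one. The closed range is the
    one that [ge0_integral_cos_shift] accepts. *)
Lemma polar_angle (z : R * R) : exists phi, [/\ 0 <= phi <= 2 * pi,
  z.1 = enorm z * cos phi & z.2 = enorm z * sin phi].
Proof.
have pi0 := pi_ge0 R.
have nz : 0 <= z.1 ^+ 2 + z.2 ^+ 2 by rewrite addr_ge0 ?sqr_ge0.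
have e2 : enorm z ^+ 2 = z.1 ^+ 2 + z.2 ^+ 2 by rewrite sqr_sqrtr.
have [z0|z0] := eqVneq (enorm z) 0.
  exists 0; rewrite z0 !mul0r; have : z.1 ^+ 2 + z.2 ^+ 2 == 0 by rewrite -e2 z0 expr0n.
  rewrite paddr_eq0 ?sqr_ge0// !sqrf_eq0 => /andP[/eqP-> /eqP->]; split => //.
  by apply/andP; lra.
have ep : 0 < enorm z by rewrite lt_neqAle eq_sym z0 sqrtr_ge0.
pose c := z.1 / enorm z.
have zc : z.1 = enorm z * c by rewrite /c mulrC divfK.
have c1 : -1 <= c <= 1.
  rewrite -ler_norml -(@ler_pXn2r _ 2) ?nnegrE// real_normK ?num_real// expr1n.
  by rewrite /c expr_div_n ler_pdivrMr ?exprn_gt0// mul1r e2 lerDl sqr_ge0.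
have sc : (enorm z * Num.sqrt (1 - c ^+ 2)) ^+ 2 = z.2 ^+ 2.
  rewrite exprMn (@sqr_sqrtr _ (1 - c ^+ 2)); last first.
    by rewrite subr_ge0 -(@real_normK _ c) ?num_real// exprn_ile1// ler_norml.
  by rewrite mulrBr mulr1 -exprMn -zc e2 addrC addKr.
have [y0|y0] := leP 0 z.2.
  exists (acos c); split.
  - have := acos_ge0 c1; have := acos_lepi c1 => *; apply/andP; lra.
  - by rewrite acosK// in_itv/= c1.
  - rewrite sin_acos//; apply/eqP; rewrite -(@eqrXn2 _ 2)//; first by rewrite sc.
    by rewrite mulr_ge0 ?sqrtr_ge0.
exists (2 * pi - acos c); split.
- have := acos_ge0 c1; have := acos_lepi c1 => *; apply/andP; lra.
- rewrite addrC mulr_natl cosD2pi cosN acosK// in_itv/= c1//.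
- rewrite addrC mulr_natl sinD2pi sinN sin_acos// mulrN.
  apply/eqP; rewrite -eqr_oppLR -(@eqrXn2 _ 2)//; first by rewrite sqrrN -sc.
    by rewrite oppr_ge0 ltW.
  by rewrite mulr_ge0 ?sqrtr_ge0.
Qed.

Lemma measurable_cos : measurable_fun setT (@cos R).
Proof. by apply: continuous_measurable_fun; exact: continuous_cos. Qed.
Lemma measurable_sin : measurable_fun setT (@sin R).
Proof. by apply: continuous_measurable_fun; exact: continuous_sin. Qed.

Lemma ge0_integral_cos_shift (g : R -> \bar R) phi :
  measurable_fun setT g -> (forall x, 0 <= g x)%E -> 0 <= phi <= 2 * pi ->
  (\int[leb]_(x in `[0%R, (2 * pi)%R]) g (cos (x - phi)) =
   \int[leb]_(x in `[0%R, (2 * pi)%R]) g (cos x))%E.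
Proof.
move=> mg g0 p0.
have cP x : cos (x + 2 * pi) = cos x :> R by rewrite mulr_natl cosD2pi.
(* Shifting by [- phi] is shifting by [2 * pi - phi] up to a period, and the latter lies in
   [[0, 2 * pi]]. *)
have <- := @ge0_integral_periodic R (2 * pi) (g \o cos) _ _ _ (2 * pi - phi).
- by apply: eq_integral => x _ /=; rewrite [(2 * pi - phi)%R]addrC addrA cP.
- exact: (measurableT_comp mg measurable_cos).
- by move=> x; exact: g0.
- by move=> x /=; rewrite cP.
- by apply/andP; lra.
Qed.

Lemma lebesgue_measure_cos_gt (c : R) : -1 <= c <= 1 ->
  leb ([set th | c < cos th] `&` `[0, 2 * pi]) = (2 * acos c)%:E.
Proof.
move=> c1; have a0 := acos_ge0 c1; have ap := acos_lepi c1.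
have cP x : cos (2 * pi - x) = cos x :> R.
  by rewrite addrC mulr_natl cosD2pi cosN.
have key x : 0 <= x <= pi -> (c < cos x) = (x < acos c).
  move=> x0; rewrite -[in LHS](@acosK _ c) ?in_itv//= ltr_cos ?in_itv//=.
  by rewrite a0 ap.
(* The arc around the angle 0 is cut in two by the choice of [[0, 2 * pi]]. *)
rewrite (_ : _ `&` _ = `[0, acos c[ `|` `]2 * pi - acos c, 2 * pi])%classic.
  rewrite measureU//=; last 1 first.
    apply/seteqP; split => // x /=; rewrite !in_itv/=; lra.
  rewrite !lebesgue_measure_itv/= !lte_fin.
  move: a0; rewrite le_eqVlt => /predU1P[<-|a0].
    by rewrite ltxx subr0 ltxx mulr0 adde0.
  rewrite a0 (_ : (_ < _) = true); last lra.
  by rewrite -!EFinB -EFinD; congr EFin; ring.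
have pi0 := pi_ge0 R.
apply/seteqP; split => x /=; rewrite !in_itv/=.
  move=> [cx /andP[x0 x2]]; have [xp|xp] := leP x pi.
    by left; rewrite x0/= -key// x0.
  right; rewrite x2 andbT; move: cx; rewrite -cP key => [|]; first lra.
  apply/andP; lra.
move=> [/andP[x0 xc]|/andP[x0 xc]].
  by split; [rewrite key//|]; apply/andP; lra.
split; last by apply/andP; lra.
rewrite -cP key; first lra.
by apply/andP; lra.
Qed.
End circle.

(** * A grid on the space of marks (speed, ((abscissa, ordinate), direction)) *)

Section grid.
Variable R : realType.
Notation mR := (measurableTypeR R).

Definition box_set (B : box R) : set (mR * ((mR * mR) * mR)) :=
  [set m | in_box B m.2.1.1 m.2.1.2 m.1 m.2.2].

Lemma box_setE (B : box R) : box_set B =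
  (`]bv1 B, bv2 B] `*` ((`]bx1 B, bx2 B] `*` `]by1 B, by2 B]) `*` `]bt1 B, bt2 B]))%classic.
Proof.
apply/seteqP; split => -[v [[x y] th]] /=; rewrite /box_set/= /in_box.
  by move=> [? [? []]].
by move=> [? [[? ?] ?]].
Qed.

Lemma measurable_box_set (B : box R) : measurable (box_set B).
Proof.
rewrite box_setE; apply: measurableX => //; apply: measurableX => //.
exact: measurableX.
Qed.

(* At level [n] the grid has mesh [1 / (n + 1)] and fills [-(n + 1), n + 1]:
   refining and growing at once leaves a single limit to take. *)
Definition grid_pt (n k : nat) : R := k%:R / n.+1%:R - n.+1%:R.
Definition grid_size (n : nat) : nat := (2 * n.+1 * n.+1)%N.

Lemma grid_ptS n k : grid_pt n k.+1 = grid_pt n k + n.+1%:R^-1.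
Proof. by rewrite /grid_pt -natr1 mulrDl mul1r addrAC. Qed.

Lemma ltr_grid_pt n k : grid_pt n k < grid_pt n k.+1.
Proof. by rewrite grid_ptS ltrDl invr_gt0 ltr0n. Qed.

Lemma grid_pt_inj n (k k' : nat) (x : R) :
  grid_pt n k < x <= grid_pt n k.+1 -> grid_pt n k' < x <= grid_pt n k'.+1 -> k = k'.
Proof.
have aux (a b : nat) : grid_pt n a < x -> x <= grid_pt n b.+1 -> (a <= b)%N.
  move=> ax xb; have := lt_le_trans ax xb.
  by rewrite /grid_pt ltrD2r ltr_pM2r ?invr_gt0 ?ltr0n// ltr_nat ltnS.
move=> /andP[a1 a2] /andP[b1 b2]; apply/eqP; rewrite eqn_leq.
by rewrite (aux k k')// (aux k' k).
Qed.

Lemma grid_pt_ex n (x : R) : - n.+1%:R < x <= n.+1%:R ->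
  exists k : 'I_(grid_size n), grid_pt n k < x <= grid_pt n k.+1.
Proof.
move=> /andP[x1 x2].
have n0 : (0 : R) < n.+1%:R by rewrite ltr0n.
have : exists k, x <= grid_pt n k.
  exists (grid_size n); rewrite /grid_pt /grid_size !natrM mulfK ?gt_eqF//; lra.
move=> exk; pose k := ex_minn exk.
have [xk kmin] : x <= grid_pt n k /\ forall j, x <= grid_pt n j -> (k <= j)%N.
  by rewrite /k; case: ex_minnP.
have k0 : (0 < k)%N.
  rewrite lt0n; apply: contraTneq xk => ->.
  by rewrite /grid_pt mul0r add0r -ltNge.
have kN : (k <= grid_size n)%N.
  by apply: kmin; rewrite /grid_pt /grid_size !natrM mulfK ?gt_eqF//; lra.
have k1N : (k.-1 < grid_size n)%N by rewrite prednK.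
exists (Ordinal k1N) => /=; rewrite prednK// xk andbT ltNge.
by apply/negP => /kmin; rewrite -ltnS prednK// ltnn.
Qed.

Definition grid_idx (n : nat) : Type :=
  ('I_(grid_size n) * (('I_(grid_size n) * 'I_(grid_size n)) * 'I_(grid_size n)))%type.
HB.instance Definition _ n := Finite.on (grid_idx n).

Definition grid_box n (c : grid_idx n) : box R :=
  Box (grid_pt n c.2.1.1) (grid_pt n c.2.1.1.+1) (grid_pt n c.2.1.2) (grid_pt n c.2.1.2.+1)
      (grid_pt n c.1) (grid_pt n c.1.+1) (grid_pt n c.2.2) (grid_pt n c.2.2.+1).

Definition cell n (c : grid_idx n) := box_set (grid_box c).

Lemma grid_box_ok n (c : grid_idx n) : box_ok (grid_box c).
Proof. by do ![split]; rewrite /= ltW// ltr_grid_pt. Qed.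

Lemma cellP n (c : grid_idx n) m : cell c m <->
  [/\ grid_pt n c.1 < m.1 <= grid_pt n c.1.+1,
      grid_pt n c.2.1.1 < m.2.1.1 <= grid_pt n c.2.1.1.+1,
      grid_pt n c.2.1.2 < m.2.1.2 <= grid_pt n c.2.1.2.+1 &
      grid_pt n c.2.2 < m.2.2 <= grid_pt n c.2.2.+1].
Proof.
rewrite /cell /box_set/= /in_box/= !in_itv/=.
by split=> [[? [? [? ?]]]|[? ? ? ?]].
Qed.

Lemma cell_inj n (c c' : grid_idx n) m : cell c m -> cell c' m -> c = c'.
Proof.
move=> /cellP[h1 h2 h3 h4] /cellP[k1 k2 k3 k4].
case: c h1 h2 h3 h4 => [c1 [[c2 c3] c4]] /= h1 h2 h3 h4.
case: c' k1 k2 k3 k4 => [d1 [[d2 d3] d4]] /= k1 k2 k3 k4.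
by congr (_, (_, _, _)); apply: val_inj; [exact: grid_pt_inj h1 k1|
  exact: grid_pt_inj h2 k2|exact: grid_pt_inj h3 k3|exact: grid_pt_inj h4 k4].
Qed.

(** Needed for [notin_beatset]: an empty cell would vacuously beat itself. *)
Lemma cell_neq0 n (c : grid_idx n) : exists m, cell c m.
Proof.
exists (grid_pt n c.1.+1, ((grid_pt n c.2.1.1.+1, grid_pt n c.2.1.2.+1), grid_pt n c.2.2.+1)).
by apply/cellP; split; rewrite /= lexx ltr_grid_pt.
Qed.

Definition cube (M : nat) : set (mR * ((mR * mR) * mR)) :=
  box_set (Box (- M%:R) M%:R (- M%:R) M%:R (- M%:R) M%:R (- M%:R) M%:R).

Lemma cubeP M m : cube M m <->
  [/\ - M%:R < m.1 <= M%:R, - M%:R < m.2.1.1 <= M%:R,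
      - M%:R < m.2.1.2 <= M%:R & - M%:R < m.2.2 <= M%:R].
Proof.
rewrite /cube /box_set/= /in_box/= !in_itv/=.
by split=> [[? [? [? ?]]]|[? ? ? ?]].
Qed.

Lemma cube_cell M n m : (M <= n.+1)%N -> cube M m -> exists c : grid_idx n, cell c m.
Proof.
move=> Mn /cubeP[h1 h2 h3 h4].
have W (x : R) : - M%:R < x <= M%:R -> - n.+1%:R < x <= n.+1%:R.
  move=> /andP[a b]; move: Mn; rewrite -(ler_nat R) => Mn; apply/andP; split; lra.
have [k1 K1] := grid_pt_ex (W _ h1).
have [k2 K2] := grid_pt_ex (W _ h2).
have [k3 K3] := grid_pt_ex (W _ h3).
have [k4 K4] := grid_pt_ex (W _ h4).
by exists (k1, ((k2, k3), k4)); apply/cellP.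
Qed.

Lemma cubeS M m : cube M m -> cube M.+1 m.
Proof.
have W (x : R) : - M%:R < x <= M%:R -> - M.+1%:R < x <= M.+1%:R.
  by move=> /andP[a b]; rewrite -natr1; apply/andP; split; lra.
by move=> /cubeP[h1 h2 h3 h4]; apply/cubeP; split; apply: W.
Qed.

Lemma bigcup_cube : \bigcup_M cube M = setT.
Proof.
apply/seteqP; split => // -[v [[x y] th]] _.
pose b (z : R) := (Num.bound `|z|).
exists (maxn (maxn (b v) (b x)) (maxn (b y) (b th))) => //.
have W (z : R) N : (b z <= N)%N -> - N%:R < z <= N%:R.
  move=> bN; have : `|z| < N%:R.
    by apply: (@lt_le_trans _ _ (b z)%:R); [exact: archi_boundP|rewrite ler_nat].
  by rewrite ltr_norml => /andP[-> /ltW ->].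
by apply/cubeP; split; apply: W; rewrite !leq_max leqnn ?orbT.
Qed.

Lemma cell_dist n (c : grid_idx n) m m' : cell c m -> cell c m' ->
  [/\ `|m.1 - m'.1| <= n.+1%:R^-1, `|m.2.1.1 - m'.2.1.1| <= n.+1%:R^-1,
      `|m.2.1.2 - m'.2.1.2| <= n.+1%:R^-1 & `|m.2.2 - m'.2.2| <= n.+1%:R^-1].
Proof.
have W k (x y : R) : grid_pt n k < x <= grid_pt n k.+1 -> grid_pt n k < y <= grid_pt n k.+1 ->
    `|x - y| <= n.+1%:R^-1.
  rewrite grid_ptS ler_norml; move: (grid_pt n k) (n.+1%:R^-1 : R) => g e.
  move=> /andP[? ?] /andP[? ?]; apply/andP; split; lra.
move=> /cellP[h1 h2 h3 h4] /cellP[k1 k2 k3 k4].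
by split; [exact: W h1 k1|exact: W h2 k2|exact: W h3 k3|exact: W h4 k4].
Qed.

Lemma cell_cube M n (c : grid_idx n) m : cell c m -> cube M m -> cell c `<=` cube M.+1.
Proof.
move=> cm /cubeP[h1 h2 h3 h4] m' cm'; have [k1 k2 k3 k4] := cell_dist cm cm'.
have W (x y : R) : - M%:R < x <= M%:R -> `|x - y| <= n.+1%:R^-1 ->
    - M.+1%:R < y <= M.+1%:R.
  have n1 : n.+1%:R^-1 <= (1 : R) by rewrite invf_le1 ?ltr0n// ler1n.
  move=> /andP[x1 x2] /le_trans/(_ n1); rewrite ler_norml => /andP[y1 y2].
  by rewrite -(natr1 M); apply/andP; split; lra.
by apply/cubeP; split; [exact: W h1 k1|exact: W h2 k2|exact: W h3 k3|exact: W h4 k4].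
Qed.

(** Balls of the product are balls for the maximum distance, so the coordinatewise bounds of
    [cell_dist] suffice. *)
Lemma cell_shrink (m : R * ((R * R) * R)) (U : set (R * ((R * R) * R))) : nbhs m U ->
  \forall n \near \oo, forall c : grid_idx n, cell c m -> cell c `<=` U.
Proof.
move=> /nbhs_ballP[e /= e0 eU]; near=> n => c cm m' cm'; apply: eU.
have [k1 k2 k3 k4] := cell_dist cm cm'.
have ne : n.+1%:R^-1 < e by near: n; exact: near_infty_natSinv_lt (PosNum e0).
do ![split]; apply: le_lt_trans ne => //.
Unshelve. all: by end_near. Qed.

Lemma near_cell (m : R * ((R * R) * R)) :
  \forall n \near \oo, exists c : grid_idx n, cell c m.
Proof.
have : (\bigcup_M cube M) m by rewrite bigcup_cube.
move=> [M _ Mm]; near=> n; apply: (@cube_cell M) => //.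
by apply: leqW; near: n; exists M.
Unshelve. all: by end_near. Qed.

End grid.

(** * Comparing two stations at the times 0 and t *)

Section beats.
Variable R : realType.
Notation mR := (measurableTypeR R).

(* Squared horizontal distance to the user at time [s] of a station with mark
   [m]; the height [h] plays no role in comparing distances. *)
Definition sqd (s : R) (m : R * ((R * R) * R)) : R :=
  (m.2.1.1 + s * m.1 * cos m.2.2) ^+ 2 + (m.2.1.2 + s * m.1 * sin m.2.2) ^+ 2.

Lemma continuous_sqd s : continuous (sqd s).
Proof.
move=> m.
have c1 : {for m, continuous (fun m : R * ((R * R) * R) => m.1)} by exact: cvg_fst.
have c2 : {for m, continuous (fun m : R * ((R * R) * R) => m.2)} by exact: cvg_snd.
have c22 : {for m, continuous (fun m : R * ((R * R) * R) => m.2.2)}.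
  exact: (@continuous_comp _ _ _ (fun m : R * ((R * R) * R) => m.2) snd m c2 cvg_snd).
have c21 : {for m, continuous (fun m : R * ((R * R) * R) => m.2.1)}.
  exact: (@continuous_comp _ _ _ (fun m : R * ((R * R) * R) => m.2) fst m c2 cvg_fst).
have c211 : {for m, continuous (fun m : R * ((R * R) * R) => m.2.1.1)}.
  exact: (@continuous_comp _ _ _ (fun m : R * ((R * R) * R) => m.2.1) fst m c21 cvg_fst).
have c212 : {for m, continuous (fun m : R * ((R * R) * R) => m.2.1.2)}.
  exact: (@continuous_comp _ _ _ (fun m : R * ((R * R) * R) => m.2.1) snd m c21 cvg_snd).
have sq (f : R * ((R * R) * R) -> R) : {for m, continuous f} ->
    {for m, continuous (fun m => f m ^+ 2)}.
  move=> cf; apply: (@continuous_comp _ _ _ f (fun x => x ^+ 2)) => //.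
  exact: exprn_continuous.
apply: cvgD; apply: sq; apply: cvgD => //; apply: cvgM; [|  | |].
- by apply: cvgM => //; exact: cvg_cst.
- by apply: continuous_comp => //; exact: continuous_cos.
- by apply: cvgM => //; exact: cvg_cst.
- by apply: continuous_comp => //; exact: continuous_sin.
Qed.

Lemma measurable_sqd s :
  measurable_fun setT (sqd s : mR * ((mR * mR) * mR) -> R).
Proof.
have m22 : measurable_fun setT (fun m : mR * ((mR * mR) * mR) => m.2.2).
  exact: (measurableT_comp measurable_snd measurable_snd).
have m21 : measurable_fun setT (fun m : mR * ((mR * mR) * mR) => m.2.1).
  exact: (measurableT_comp measurable_fst measurable_snd).
have m1 : measurable_fun setT (fun m : mR * ((mR * mR) * mR) => m.1).
  exact: measurable_fst.
have ms := @measurable_sin R; have mc := @measurable_cos R.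
apply: measurable_funD; apply: measurable_funX; apply: measurable_funD.
- exact: (measurableT_comp measurable_fst m21).
- apply: measurable_funM; first exact: measurable_funM.
  exact: (measurableT_comp mc m22).
- exact: (measurableT_comp measurable_snd m21).
- apply: measurable_funM; first exact: measurable_funM.
  exact: (measurableT_comp ms m22).
Qed.

Lemma measurable_sqd_lt s (r : R) : measurable [set m : mR * ((mR * mR) * mR) | sqd s m < r].
Proof.
have := @measurable_fun_ltr _ _ _ setT _ (cst r) (@measurable_sqd s) (measurable_cst r).
by move=> /(_ measurableT [set true]); rewrite setTI; exact.
Qed.

(** Here [m'] is the winner: being strictly closer at one of the two times already prevents [m] from
    serving at both. A mark never beats itself. *)
Definition beats (t : R) (m m' : R * ((R * R) * R)) : Prop :=
  sqd 0 m' < sqd 0 m \/ sqd t m' < sqd t m.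

Lemma beats_near t m m' : beats t m m' -> \forall n \near \oo,
  forall c c' : grid_idx n, cell c m -> cell c' m' ->
  forall p p', cell c p -> cell c' p' -> beats t p p'.
Proof.
have aux s : sqd s m' < sqd s m -> \forall n \near \oo,
    forall c c' : grid_idx n, cell c m -> cell c' m' ->
    forall p p', cell c p -> cell c' p' -> sqd s p' < sqd s p.
  move=> sm; pose z := (sqd s m' + sqd s m) / 2.
  have zm : sqd s m' < z by rewrite /z; lra.
  have zm' : z < sqd s m by rewrite /z; lra.
  have n1 : nbhs m [set p | z < sqd s p] by exact: (cvgr_gt _ (@continuous_sqd s m)).
  have n2 : nbhs m' [set p | sqd s p < z] by exact: (cvgr_lt _ (@continuous_sqd s m')).
  have e1 := cell_shrink n1; have e2 := cell_shrink n2.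
  apply: filterS2 e1 e2 => n h1 h2 c c' cm cm' p p' cp cp'.
  exact: lt_trans (h2 _ cm' _ cp') (h1 _ cm _ cp).
move=> [/aux|/aux]; apply: filterS => n h c c' cm cm' p p' cp cp'; [left|right];
  exact: h cm cm' _ _ cp cp'.
Qed.

End beats.

(** * Measures of sets that eventually contain each point *)

Section approx.
Context d (T : measurableType d) (R : realType) (nu : {measure set T -> \bar R}).

(** Grids of different levels are not nested in general, so [S] is not assumed monotone. The tail
    intersections [U] are, and they still cover [X]. *)
Lemma near_measure_gt (S : (set T)^nat) (X : set T) (r : \bar R) :
  (forall n, measurable (S n)) -> measurable X ->
  (forall x, X x -> \forall n \near \oo, S n x) ->
  (r < nu X)%E -> \forall n \near \oo, (r < nu (S n))%E.
Proof.
move=> mS mX XS rX.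
pose U n := \bigcap_(k in [set k | n <= k]%N) S k.
have mU n : measurable (U n) by apply: bigcap_measurable => //; exists n => /=.
have mUU : measurable (\bigcup_n U n) by exact: bigcupT_measurable.
have XU : X `<=` \bigcup_n U n by move=> x /XS [N _ h]; exists N.
have ndU : nondecreasing_seq U.
  by move=> m n mn; apply/subsetPset => x Ux k /= nk; apply: Ux; exact: leq_trans nk.
have := @nondecreasing_cvg_mu _ _ _ nu U mU mUU ndU.
have rU : (r < nu (\bigcup_n U n))%E.
  by apply: lt_le_trans rX _; rewrite le_measure// inE.
move=> /(_ [set y | r < y]%E) cU.
have : nbhs (nu (\bigcup_n U n)) [set y | r < y]%E.
  have o : open [set y : \bar R | r < y]%E by exact: open_ereal_gt_ereal.
  exact: (open_nbhs_nbhs (conj o rU)).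
move=> /cU [N _ hN]; exists N => // n /= Nn; apply: lt_le_trans (hN n Nn) _ => /=.
by rewrite le_measure ?inE// => x; apply => /=.
Qed.

Lemma le_measure_approx (S : (set T)^nat) (X : set T) (b : \bar R) :
  (forall n, measurable (S n)) -> measurable X ->
  (forall x, X x -> \forall n \near \oo, S n x) ->
  (forall n, nu (S n) <= b)%E -> (nu X <= b)%E.
Proof.
move=> mS mX XS Sb; rewrite leNgt; apply/negP => bX.
have [N _ /(_ N (leqnn N))] := near_measure_gt mS mX XS bX.
by rewrite ltNge Sb.
Qed.
End approx.

Lemma limn_einf_ge (R : realType) (u : (\bar R)^nat) (x : R) :
  (forall r : R, r < x -> \forall n \near \oo, (r%:E <= u n)%E) ->
  (x%:E <= limn_einf u)%E.
Proof.
move=> h; rewrite limn_einf_lim; apply/lee_addgt0Pr => e e0.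
have [N _ hN] := h (x - e) ltac:(lra).
rewrite -leeBlDr//; apply: lime_ge; first exact: is_cvg_einfs.
exists N => // n /= Nn; apply: le_ereal_inf_tmp => _ [k /= nk <-].
by rewrite -EFinB; apply: hN => /=; exact: leq_trans nk.
Qed.

Section cells.
Variable R : realType.
Notation mR := (measurableTypeR R).

Definition cells n (A : {set grid_idx n}) : set (mR * ((mR * mR) * mR)) :=
  \bigcup_(c in [set` A]) cell c.

Lemma measurable_cell n (c : grid_idx n) : measurable (@cell R n c).
Proof. exact: measurable_box_set. Qed.

Lemma measurable_cells n (A : {set grid_idx n}) : measurable (cells A).
Proof. by apply: fin_bigcup_measurable => // c _; exact: measurable_cell. Qed.

Lemma measure_cells (nu : {measure set (mR * ((mR * mR) * mR)) -> \bar R}) n (A : {set grid_idx n}) :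
  nu (cells A) = (\sum_(c in A) nu (cell c))%E.
Proof.
rewrite /cells measure_fin_bigcup//.
- rewrite -big_enum [RHS]fsbig_seq ?enum_uniq//.
  by congr (\big[_/_]_(i \in _) _); apply/seteqP; split=> c /=; rewrite mem_enum.
- by move=> c c' _ _ [m [cm c'm]]; exact: cell_inj cm c'm.
- by move=> c _; exact: measurable_cell.
Qed.

Definition inner n (O : set (mR * ((mR * mR) * mR))) :=
  cells [set c : grid_idx n | `[< cell c `<=` O >]].

Lemma innerS n O : inner n O `<=` O.
Proof. by move=> m [c /=]; rewrite inE => /asboolP cO /cO. Qed.

Lemma near_inner (O : set (R * ((R * R) * R))) m : nbhs m O ->
  \forall n \near \oo, inner n O m.
Proof.
move=> mO; apply: filterS2 (near_cell m) (cell_shrink mO) => n [c cm] h.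
by exists c => //=; rewrite inE; apply/asboolP; exact: h.
Qed.
End cells.

Lemma limn_einf_le (R : realType) (u : (\bar R)^nat) (b : \bar R) :
  (\forall n \near \oo, (u n <= b)%E) -> (limn_einf u <= b)%E.
Proof.
move=> [N _ hN]; rewrite limn_einf_lim; apply: lime_le; first exact: is_cvg_einfs.
exists N => // n /= Nn; apply: le_trans (hN n Nn).
by apply: ereal_inf_lbound; exists n => /=.
Qed.

(** * The probability that the server is the same at both times *)

Section void_estimate.
Context d (Omega : measurableType d) (R : realType) (P : probability Omega R).
Notation mR := (measurableTypeR R).
Notation Mk := (mR * ((mR * mR) * mR))%type.
Variables (station : nat -> Omega -> Mk) (L : {sigma_finite_measure set Mk -> \bar R}).
Hypothesis mstation : forall i, measurable_fun setT (station i).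
Hypothesis Lcell : forall n (c : grid_idx n), (L (cell c) < +oo)%E.

Definition no_station_in n (A : {set grid_idx n}) : set Omega :=
  [set w | forall i c, c \in A -> ~ cell c (station i w)].

(** Of the Poisson property, only the void probabilities of finite unions of cells enter this
    section. *)
Hypothesis P_no_station : forall n (A : {set grid_idx n}),
  P (no_station_in A) = (expR (- fine (L (cells A))))%:E.

Let Lcells n (A : {set grid_idx n}) : L (cells A) \is a fin_num.
Proof.
rewrite measure_cells; apply/sum_fin_numP => c _ _.
by rewrite ge0_fin_numE//; exact: Lcell.
Qed.

Lemma measurable_no_station_in n (A : {set grid_idx n}) : measurable (no_station_in A).
Proof.
rewrite (_ : no_station_in A = \bigcap_i \bigcap_(c in [set` A]) ~` (station i @^-1` cell c)).
  apply: bigcapT_measurable => i; apply: fin_bigcap_measurable => // c _.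
  apply: measurableC; rewrite -[X in measurable X]setTI.
  by apply: mstation => //; exact: measurable_cell.
apply/seteqP; split => w /=.
  by move=> h i _ c cA; exact: h.
by move=> h i c cA; exact: h.
Qed.

Let hit n (c : grid_idx n) (A : {set grid_idx n}) := no_station_in A `\` no_station_in (c |: A).

Let measurable_hit n (c : grid_idx n) A : measurable (hit c A).
Proof. by apply: measurableD; exact: measurable_no_station_in. Qed.

(** [hit] is a difference of two void events. With [c] outside [A] the masses add, and the
    probability [expR (- a) * (1 - expR (- l))] is bounded through [1 - expR (- l) <= l]. *)
Lemma le_hit n (c : grid_idx n) (A : {set grid_idx n}) : c \notin A ->
  (P (hit c A) <= L (cell c) * (expR (- fine (L (cells A))))%:E)%E.
Proof.
move=> cA; have -> : P (hit c A) = (P (no_station_in A) - P (no_station_in (c |: A)))%E.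
  rewrite measureD; last 3 first.
  - exact: measurable_no_station_in.
  - exact: measurable_no_station_in.
  - by rewrite (le_lt_trans (probability_le1 _ _)) ?ltry//; exact: measurable_no_station_in.
  by rewrite setIidr// => w /= h i c' c'A; apply: h; rewrite inE c'A orbT.
rewrite !P_no_station.
have -> : L (cells (c |: A)) = (L (cell c) + L (cells A))%E.
  by rewrite measure_cells big_setU1//= -measure_cells.
have fc : L (cell c) \is a fin_num by rewrite ge0_fin_numE// Lcell.
rewrite fineD//.
set a := fine (L (cells A)); set l := fine (L (cell c)).
rewrite -[L (cell c)]fineK// -/l -EFinM -EFinB lee_fin.
rewrite opprD expRD -[X in X - _]mul1r -mulrBl ler_wpM2r ?expR_ge0//.
by have := expR_ge1Dx (- l); lra.
Qed.

Variable t : R.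

(** All pairs of marks are required to compare: wherever in [c] the server sits, a station in one of
    these cells would dethrone it. *)
Definition beatset n (c : grid_idx n) : {set grid_idx n} :=
  [set c' | `[< forall m m' : R * ((R * R) * R), cell c m -> cell c' m' -> beats t m m' >]].

Lemma notin_beatset n (c : grid_idx n) : c \notin beatset c.
Proof.
rewrite inE; apply/negP => /asboolP h; have [m cm] := cell_neq0 R c.
by have [|] := h m m cm cm; rewrite ltxx.
Qed.

Definition keeps_server M : set Omega :=
  [set w | exists2 i, cube M (station i w) & forall j, ~ beats t (station i w) (station j w)].

Let inner_cells n M : {set grid_idx n} := [set c | `[< cell c `<=` @cube R M >]].

(** [M <= n] makes the grid cover the cube. A cell that meets the cube of size [M] may stick out of
    it, but its sides are at most 1, hence [M.+1]. *)
Lemma keeps_server_sub M n : (M <= n)%N ->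
  keeps_server M `<=` \bigcup_(c in [set` inner_cells n M.+1]) hit c (beatset c).
Proof.
move=> Mn w [i Mi nb]; have [c ci] := cube_cell (leqW Mn) Mi.
exists c => /=; first by rewrite inE; apply/asboolP; exact: cell_cube ci Mi.
split => [j c'|]; last by move=> /(_ i c); rewrite !inE eqxx => /(_ erefl).
by rewrite inE => /asboolP h c'j; apply: (nb j); exact: h ci c'j.
Qed.

Let k n (c : grid_idx n) : R := expR (- fine (L (cells (beatset c)))).

Let k01 n (c : grid_idx n) : 0 <= k c <= 1.
Proof. by rewrite expR_ge0/= -expR0 ler_expR oppr_le0 fine_ge0. Qed.

(** The step function whose integral is the sum over the cells: sums over different grids become
    integrals of functions on one fixed space. *)
Let f M n (m : Mk) : R := \sum_(c in inner_cells n M) k c * \1_(cell c) m.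

Let f0E M n m : (forall c : grid_idx n, ~ cell c m) -> f M n m = 0.
Proof.
move=> h; rewrite /f big1// => c _; by rewrite indicE memNset ?mulr0.
Qed.

Let fE M n (c : grid_idx n) m : cell c m ->
  f M n m = if c \in inner_cells n M then k c else 0.
Proof.
move=> cm; have h (c' : grid_idx n) : c' != c -> k c' * \1_(cell c') m = 0.
  move=> c'c; rewrite indicE memNset ?mulr0// => c'm.
  by move: c'c; rewrite (cell_inj cm c'm) eqxx.
case: ifPn => cM.
  by rewrite /f (bigD1 c)//= big1 ?addr0 ?indicE ?mem_set ?mulr1// => c' /andP[_ /h].
rewrite /f big1// => c' c'M; apply: h; apply: contraNneq cM => <-//.
Qed.

Let f_ge0 M n m : 0 <= f M n m.
Proof. by apply: sumr_ge0 => c _; rewrite mulr_ge0//; case/andP: (k01 c). Qed.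

Let f_le1 M n m : f M n m <= 1.
Proof.
have [[c cm]|h] := pselect (exists c : grid_idx n, cell c m).
  by rewrite (fE _ cm); case: ifP => // _; case/andP: (k01 c).
by rewrite f0E// => c cm; apply: h; exists c.
Qed.

Let mf M n : measurable_fun setT (f M n).
Proof.
have -> : f M n = (fun m => \sum_(c <- enum (inner_cells n M)) k c * \1_(cell c) m).
  by apply/funext => m; rewrite big_enum.
apply: measurable_sum => c; apply: measurable_funM => //.
by apply: measurable_indic; exact: measurable_cell.
Qed.

Let integral_f M n : (\int[L]_(m in @cube R M) (f M n m)%:E =
  \sum_(c in inner_cells n M) L (cell c) * (k c)%:E)%E.
Proof.
under eq_integral do rewrite /f -sumEFin -big_enum/=.
have mc (c : grid_idx n) : measurable_fun (@cube R M) (fun m => (k c * \1_(cell c) m)%:E).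
  apply: measurable_funTS; apply/measurable_EFinP; apply: measurable_funM => //.
  by apply: measurable_indic; exact: measurable_cell.
rewrite ge0_integral_sum//; last 2 first.
- exact: measurable_box_set.
- by move=> c m _; rewrite lee_fin mulr_ge0//; case/andP: (k01 c).
rewrite big_enum/=; apply: eq_bigr => c; rewrite inE => /asboolP cM.
under eq_integral do rewrite EFinM.
rewrite ge0_integralZl_EFin; last 4 first.
- exact: measurable_box_set.
- by move=> m _; rewrite lee_fin.
- apply: measurable_funTS; apply/measurable_EFinP; apply: measurable_indic.
  exact: measurable_cell.
- by case/andP: (k01 c).
rewrite integral_indic//; last 2 first.
- exact: measurable_box_set.
- exact: measurable_cell.
by rewrite muleC setIidl.
Qed.

Lemma le_keeps_server_integral M n : (M <= n)%N -> measurable (keeps_server M) ->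
  (P (keeps_server M) <= \int[L]_(m in @cube R M.+1) (f M.+1 n m)%:E)%E.
Proof.
move=> Mn mS; rewrite integral_f.
apply: (le_trans (le_measure _ _ _ (keeps_server_sub Mn))).
- by rewrite inE.
- rewrite inE; apply: fin_bigcup_measurable => // c _; exact: measurable_hit.
have -> : \bigcup_(c in [set` inner_cells n M.+1]) hit c (beatset c) =
    \big[setU/set0]_(c <- enum (inner_cells n M.+1)) hit c (beatset c).
  by rewrite -bigcup_seq; apply: eq_bigcupl; split=> c /=; rewrite mem_enum.
rewrite -big_enum/=.
elim: (enum _) => [|c s ih]; first by rewrite !big_nil measure0.
rewrite !big_cons; apply: (le_trans (measureU2 _ _ _)).
- exact: measurable_hit.
- by apply: bigsetU_measurable => c' _; exact: measurable_hit.
by rewrite leeD// le_hit// notin_beatset.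
Qed.

Definition region (m : Mk) : set Mk := [set m' | beats t m m'].

Lemma measurable_beats : measurable [set mm : Mk * Mk | beats t mm.1 mm.2].
Proof.
have lts s : measurable [set mm : Mk * Mk | sqd s mm.2 < sqd s mm.1].
  have m1 : measurable_fun setT (fun mm : Mk * Mk => sqd s mm.1).
    exact: (measurableT_comp (@measurable_sqd R s) measurable_fst).
  have m2 : measurable_fun setT (fun mm : Mk * Mk => sqd s mm.2).
    exact: (measurableT_comp (@measurable_sqd R s) measurable_snd).
  have := measurable_fun_ltr m2 m1.
  by move=> /(_ measurableT [set true]); rewrite setTI; exact.
rewrite (_ : [set mm | _] = [set mm | sqd 0 mm.2 < sqd 0 mm.1] `|`
  [set mm | sqd t mm.2 < sqd t mm.1])//.
exact: measurableU.
Qed.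

Lemma regionE m : region m = xsection [set mm : Mk * Mk | beats t mm.1 mm.2] m.
Proof. by apply/seteqP; split => m'; rewrite /xsection/= inE. Qed.

Lemma measurable_region m : measurable (region m).
Proof. by rewrite regionE; apply: measurable_xsection; exact: measurable_beats. Qed.

Lemma measurable_fun_region : measurable_fun setT (fun m => L (region m)).
Proof.
under eq_fun do rewrite regionE.
by apply: measurable_fun_xsection; exact: measurable_beats.
Qed.

Let g (m : Mk) : R := expR (- fine (L (region m))).

Let mg : measurable_fun setT g.
Proof.
have h : measurable_fun setT (fun m => - fine (L (region m))).
  by apply: measurable_funN; apply: measurableT_comp => //; exact: measurable_fun_region.
exact: (measurableT_comp (@measurable_expR R) h).
Qed.

Let g01 m : 0 <= g m <= 1.
Proof. by rewrite expR_ge0/= -expR0 ler_expR oppr_le0 fine_ge0. Qed.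

(** At most one [c] contributes. The union form makes this a total function of [m], with value the
    empty set off the grid. *)
Let S n (m : Mk) : set Mk := \bigcup_(c in [set c : grid_idx n | cell c m]) cells (beatset c).

Let mS n m : measurable (S n m).
Proof.
apply: fin_bigcup_measurable => [|c _]; last exact: measurable_cells.
exact: finite_finset.
Qed.

Let SE n (c : grid_idx n) m : cell c m -> S n m = cells (beatset c).
Proof.
move=> cm; apply/seteqP; split => [m' [c' /= c'm]|m' h]; last by exists c.
by rewrite (cell_inj cm c'm).
Qed.

Let near_S m m' : region m m' -> \forall n \near \oo, S n m m'.
Proof.
move=> /beats_near h; have := near_cell m; have := near_cell m'.
apply: filterS3 h => n h [c' c'm'] [c cm].
exists c => //; exists c' => //=; rewrite inE; apply/asboolP => p p' cp c'p'.
exact: h cp c'p'.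
Qed.

(** The sets [S n m] eventually contain each point of [region m], so their mass eventually exceeds
    any level below that of the region. *)
Let liminf_f M m : ((1 - g m)%:E <= limn_einf (fun n => (1 - f M n m)%:E))%E.
Proof.
apply: limn_einf_ge => r rg.
have r1 : 0 < 1 - r by have /andP[] := g01 m; lra.
(* The mass at which the void probability equals [1 - r]. *)
pose q := - ln (1 - r).
have qG : (q%:E < L (region m))%E.
  have : q < fine (L (region m)).
    by rewrite /q ltrNl -ltr_expR lnK ?posrE// -/(g m); lra.
  have [Lf|] := boolP (L (region m) \is a fin_num).
    by rewrite -[X in (_ < X)%E](fineK Lf) lte_fin.
  (* For infinite mass [fine] returns 0 and [g m] is 1, which only weakens the bound. *)
  by rewrite ge0_fin_numE// -leNgt leye_eq => /eqP ->; rewrite ltry.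
have := near_measure_gt (fun n => mS n m) (measurable_region m) (@near_S m) qG.
apply: filterS => n; rewrite lee_fin.
have [[c cm] |h _] := pselect (exists c : grid_idx n, cell c m).
  rewrite (SE cm) (fE _ cm) => qL; case: ifPn => _; last lra.
  have {}qL : q < fine (L (cells (beatset c))) by rewrite -lte_fin fineK.
  have : k c < 1 - r; last lra.
  by rewrite /k -[ltRHS](@lnK R) ?posrE// ltr_expR ltrNl.
by rewrite f0E; [lra|move=> c cm; apply: h; exists c].
Qed.

(** A reverse Fatou argument: Fatou for [1 - f] on the cube [K], whose finite mass allows
    complementing back to [g]. The integral over [K] is then enlarged to all marks. *)
Lemma le_keeps_server M : (L (cube M.+1) < +oo)%E -> measurable (keeps_server M) ->
  (P (keeps_server M) <= \int[L]_m (expR (- fine (L (region m))))%:E)%E.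
Proof.
set K := @cube R M.+1 => LK mSt; have mK : measurable K by exact: measurable_box_set.
have LKfin : L K \is a fin_num by rewrite ge0_fin_numE.
have mfE n : measurable_fun K (fun m => (f M.+1 n m)%:E).
  by apply: measurable_funTS; apply/measurable_EFinP; exact: mf.
have m1fE n : measurable_fun K (fun m => (1 - f M.+1 n m)%:E).
  by apply: measurable_funTS; apply/measurable_EFinP; apply: measurable_funB => //; exact: mf.
have mgE : measurable_fun K (fun m => (g m)%:E).
  by apply: measurable_funTS; apply/measurable_EFinP.
have m1gE : measurable_fun K (fun m => (1 - g m)%:E).
  by apply: measurable_funTS; apply/measurable_EFinP; apply: measurable_funB.
have intK1 : (\int[L]_(m in K) 1 = L K)%E by rewrite integral_cst// mul1e.
have split_f n : (\int[L]_(m in K) (1 - f M.+1 n m)%:E + \int[L]_(m in K) (f M.+1 n m)%:E = L K)%E.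
  rewrite -ge0_integralD//.
  - by rewrite -intK1; apply: eq_integral => m _; rewrite -EFinD subrK.
  - by move=> m _; rewrite lee_fin subr_ge0.
  - by move=> m _; rewrite lee_fin.
have split_g : (\int[L]_(m in K) (1 - g m)%:E + \int[L]_(m in K) (g m)%:E = L K)%E.
  rewrite -ge0_integralD//.
  - by rewrite -intK1; apply: eq_integral => m _; rewrite -EFinD subrK.
  - by move=> m _; rewrite lee_fin subr_ge0; case/andP: (g01 m).
  - by move=> m _; rewrite lee_fin; case/andP: (g01 m).
have PE : P (keeps_server M) \is a fin_num by rewrite fin_num_measure.
have : (\int[L]_(m in K) (1 - g m)%:E <= L K - P (keeps_server M))%E.
  apply: (@le_trans _ _ (\int[L]_(m in K) limn_einf (fun n => (1 - f M.+1 n m)%:E))%E).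
    apply: ge0_le_integral => //.
    - by move=> m _; rewrite lee_fin subr_ge0; case/andP: (g01 m).
    - have -> : (fun m => limn_einf (fun n => (1 - f M.+1 n m)%:E)) =
        (fun m => - limn_esup (fun n => - (1 - f M.+1 n m)%:E))%E by [].
      apply: measurableT_comp => //; apply: measurable_fun_limn_esup => n.
      by apply: measurableT_comp => //; exact: m1fE.
  apply: (le_trans (fatou _ _ m1fE _)) => //.
    by move=> n m _; rewrite lee_fin subr_ge0.
  apply: limn_einf_le; exists M => // n /= Mn.
  rewrite leeBrDr// -(split_f n) leeD2l//; exact: le_keeps_server_integral.
rewrite leeBrDr// -split_g leeD2lE; last first.
  rewrite ge0_fin_numE; last first.
    by apply: integral_ge0 => m _; rewrite lee_fin subr_ge0; case/andP: (g01 m).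
  apply: le_lt_trans LK; rewrite -split_g leeDl//.
  by apply: integral_ge0 => m _; rewrite lee_fin; case/andP: (g01 m).
move=> /le_trans; apply; apply: ge0_subset_integral => //.
- by apply/measurable_EFinP.
- by move=> m _; rewrite lee_fin; case/andP: (g01 m).
Qed.
End void_estimate.

(** * The marked Poisson point process *)

Section poisson.
Variable R : realType.

Lemma nneseries_exp (x : R) : 0 <= x ->
  (\sum_(n <oo) (x ^+ n / n`!%:R)%:E = (expR x)%:E)%E.
Proof.
move=> x0; rewrite /expR/= -EFin_lim; last exact: is_cvg_series_exp_coeff.
apply: congr_lim; apply/funext => n /=.
by rewrite /series/= -sumEFin big_mkord.
Qed.

Lemma poisson_pmf_ge0 (m : R) n : 0 <= m -> 0 <= Defs.poisson_pmf m n.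
Proof. by move=> m0; rewrite !mulr_ge0 ?expR_ge0 ?exprn_ge0// invr_ge0. Qed.

Lemma sum_poisson_pmf (m : R) : 0 <= m ->
  (\sum_(n <oo) (Defs.poisson_pmf m n)%:E = 1)%E.
Proof.
move=> m0; transitivity (\sum_(n <oo) ((expR (- m))%:E * (m ^+ n / n`!%:R)%:E))%E.
  by apply: eq_eseriesr => n _; rewrite -EFinM /Defs.poisson_pmf mulrA.
rewrite nneseriesZl; last by move=> n _; rewrite lee_fin divr_ge0// exprn_ge0.
by rewrite nneseries_exp// -EFinM -expRD addNr expR0.
Qed.

(** The term at 0 vanishes, and [n.+1] times the weight at [n.+1] is [m] times the weight at [n]. *)
Lemma mean_poisson_pmf (m : R) : 0 <= m ->
  (\sum_(n <oo) (n%:R%:E * (Defs.poisson_pmf m n)%:E) = m%:E)%E.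
Proof.
move=> m0; rewrite nneseries_recl//; last first.
  by move=> n _; rewrite -EFinM lee_fin mulr_ge0// poisson_pmf_ge0.
rewrite mul0e add0e.
transitivity (\sum_(n <oo) (m%:E * (Defs.poisson_pmf m n)%:E))%E.
  rewrite -(@nneseries_addn R (fun n => (n%:R%:E * (Defs.poisson_pmf m n)%:E)%E) 1); last first.
    by move=> n; rewrite -EFinM lee_fin mulr_ge0// poisson_pmf_ge0.
  apply: eq_eseriesr => n _; rewrite -!EFinM; congr EFin.
  rewrite addn1 /Defs.poisson_pmf factS natrM exprS.
  have : n.+1%:R != 0 :> R by rewrite pnatr_eq0.
  have : n`!%:R != 0 :> R by rewrite pnatr_eq0 -lt0n fact_gt0.
  move=> ? ?; field.
  by apply/andP.
rewrite nneseriesZl; last by move=> n _; rewrite lee_fin poisson_pmf_ge0.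
by rewrite sum_poisson_pmf// mule1.
Qed.
End poisson.

Section pdf.
Variables (R : realType) (f : R -> R).
Hypotheses (f0 : forall x, 0 <= f x) (mf : measurable_fun setT f).
Hypothesis f1 : (\int[@lebesgue_measure R]_x (f x)%:E = 1)%E.

Definition pdf_prob (f1 : (\int[@lebesgue_measure R]_x (f x)%:E = 1)%E) :
  set (measurableTypeR R) -> \bar R := dens (@lebesgue_measure R) f0 mf.

HB.instance Definition _ := Measure.on (pdf_prob f1).

Let pdf_probT : pdf_prob f1 setT = 1%E.
Proof. exact: f1. Qed.

HB.instance Definition _ := @Measure_isProbability.Build _ _ R (pdf_prob f1) pdf_probT.

Lemma pdf_prob_itv (F : R -> R) (a b : R) : a <= b ->
  (forall x, (F x)%:E = (\int[@lebesgue_measure R]_(y in `]-oo, x]) (f y)%:E)%E) ->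
  pdf_prob f1 `]a, b] = (F b - F a)%:E.
Proof.
move=> ab FE; rewrite EFinB !FE.
rewrite [in RHS](@itv_bndbnd_setU _ _ _ (BRight a)) ?bnd_simp//.
have mfE : measurable_fun setT (EFin \o f) by apply/measurable_EFinP.
rewrite ge0_integral_setU//=; last 3 first.
  exact: measurable_funTS.
  by move=> x _; rewrite lee_fin.
  by apply/disj_setPRL => x/=; rewrite !in_itv/= => /andP[bx _]; apply/negP; rewrite -ltNge.
rewrite -FE addeAC subee ?add0e//.
Qed.
End pdf.

(** Monotone exhaustions are taken, so that both coordinates of a point are reached at a common
    index. *)
Lemma sigma_finite_product d1 d2 (T1 : measurableType d1) (T2 : measurableType d2)
    (R : realType) (m1 : {sigma_finite_measure set T1 -> \bar R})
    (m2 : {sigma_finite_measure set T2 -> \bar R}) :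
  sigma_finite setT (m1 \x m2)%E.
Proof.
have /sigma_finiteP[F [FT /(_ _ _ _)/subsetPset ndF Ffin]] := sigma_finiteT m1.
have /sigma_finiteP[G [GT /(_ _ _ _)/subsetPset ndG Gfin]] := sigma_finiteT m2.
exists (fun n => F n `*` G n) => [|n].
  apply/seteqP; split => // -[x y] _.
  have [i _ Fx] : (\bigcup_i F i) x by rewrite -FT.
  have [j _ Gy] : (\bigcup_i G i) y by rewrite -GT.
  exists (maxn i j) => //; split; first exact: (ndF _ _ (leq_maxl i j)).
  exact: (ndG _ _ (leq_maxr i j)).
have [mF F_lty] := Ffin n; have [mG G_lty] := Gfin n; split; first exact: measurableX.
by rewrite product_measure1E// lte_mul_pinfty// ge0_fin_numE.
Qed.

Section intensity.
Variables (R : realType) (lam : R) (f : R -> R).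
Notation leb := (@lebesgue_measure R).
Notation mR := (measurableTypeR R).
Hypotheses (lam0 : 0 <= lam) (f0 : forall x, 0 <= f x) (mf : measurable_fun setT f).
Hypothesis f1 : (\int[leb]_x (f x)%:E = 1)%E.

Lemma pi2_gt0 : (0 : R) < 2 * pi.
Proof. by rewrite mulr_gt0// pi_gt0. Qed.

Definition unif_angle := uniform_prob pi2_gt0.

(** Each partial product gets a name, to carry the sigma-finite structure that the next product and
    Tonelli ask for. *)
Definition plane : set (mR * mR) -> \bar R := (leb \x leb)%E.
HB.instance Definition _ := Measure.on plane.
HB.instance Definition _ :=
  Measure_isSigmaFinite.Build _ _ _ plane (sigma_finite_product leb leb).

Definition place : set ((mR * mR) * mR) -> \bar R := (plane \x unif_angle)%E.
HB.instance Definition _ := Measure.on place.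
HB.instance Definition _ :=
  Measure_isSigmaFinite.Build _ _ _ place (sigma_finite_product plane unif_angle).

(** The factor [lam] sits on the outermost coordinate, the speed, and so leaves the iterated
    integral at once. *)
Definition intensity : set (mR * ((mR * mR) * mR)) -> \bar R :=
  (mscale (NngNum lam0) (pdf_prob f0 mf f1) \x place)%E.
HB.instance Definition _ := Measure.on intensity.
HB.instance Definition _ := Measure_isSigmaFinite.Build _ _ _ intensity
  (sigma_finite_product (mscale (NngNum lam0) (pdf_prob f0 mf f1)) place).

Lemma unif_angle_itv (a b : R) : a <= b ->
  unif_angle `]a, b] = (Num.max 0 (Num.min b (2 * pi) - Num.max a 0) / (2 * pi))%:E.
Proof.
move=> ab; have p0 := pi2_gt0.
rewrite /unif_angle /uniform_prob integral_uniform_pdf.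
transitivity (\int[leb]_(x in `]a, b] `&` `[0%R, (2 * pi)%R]) ((2 * pi)^-1)%:E)%E.
  apply: eq_integral => x; rewrite inE => -[_ /=]; rewrite in_itv/= => x0.
  by rewrite /uniform_pdf x0 subr0.
rewrite integral_cst; last exact: measurableI.
rewrite /=.
rewrite [X in _ = X%:E]mulrC EFinM; congr (_ * _)%E.
(* The intersection with [[0, 2 * pi]] is open on the left at [a] when [0 <= a], and closed on the
   left at 0 otherwise. *)
have [a0|a0] := leP 0 a.
  rewrite (_ : _ `&` _ = `]a, Num.min b (2 * pi)])%classic; last first.
    apply/seteqP; split => x /=; rewrite !in_itv/= le_min.
      by move=> [/andP[-> ->] /andP[_ ->]].
    by move=> /andP[ax /andP[-> ->]]; rewrite ax (le_trans a0 (ltW ax)).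
  rewrite lebesgue_measure_itv/= lte_fin; case: ltP => h.
    by rewrite -EFinB; congr EFin; apply/esym/max_idPr; lra.
  by congr EFin; apply/esym/max_idPl; lra.
rewrite (_ : _ `&` _ = `[0, Num.min b (2 * pi)])%classic; last first.
  apply/seteqP; split => x /=; rewrite !in_itv/= le_min.
    by move=> [/andP[_ ->] /andP[-> ->]].
  by move=> /andP[ax /andP[-> ->]]; rewrite ax (lt_le_trans a0 ax).
rewrite lebesgue_measure_itv/= lte_fin; case: ltP => h.
  by rewrite -EFinB; congr EFin; apply/esym/max_idPr; lra.
by congr EFin; apply/esym/max_idPl; lra.
Qed.

Lemma intensity_box (F : R -> R) (B : box R) :
  (forall x, (F x)%:E = (\int[leb]_(y in `]-oo, x]) (f y)%:E)%E) ->
  box_ok B -> intensity (box_set B) = (box_intensity lam F B)%:E.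
Proof.
move=> FE [bx [by_ [bv bt]]]; rewrite box_setE.
have -> : intensity (`]bv1 B, bv2 B] `*` (`]bx1 B, bx2 B] `*` `]by1 B, by2 B] `*` `]bt1 B, bt2 B])) =
    (mscale (NngNum lam0) (pdf_prob f0 mf f1) `]bv1 B, bv2 B] *
     place (`]bx1 B, bx2 B] `*` `]by1 B, by2 B] `*` `]bt1 B, bt2 B]))%E.
  by apply: product_measure1E => //; apply: measurableX => //; exact: measurableX.
have -> : place (`]bx1 B, bx2 B] `*` `]by1 B, by2 B] `*` `]bt1 B, bt2 B]) =
    (plane (`]bx1 B, bx2 B] `*` `]by1 B, by2 B]) * unif_angle `]bt1 B, bt2 B])%E.
  by apply: product_measure1E => //; exact: measurableX.
have -> : plane (`]bx1 B, bx2 B] `*` `]by1 B, by2 B]) =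
    (leb `]bx1 B, bx2 B] * leb `]by1 B, by2 B])%E by exact: product_measure1E.
have -> : mscale (NngNum lam0) (pdf_prob f0 mf f1) `]bv1 B, bv2 B] =
    (lam%:E * (F (bv2 B) - F (bv1 B))%:E)%E.
  by rewrite /mscale/=; congr (_ * _)%E; exact: pdf_prob_itv.
rewrite unif_angle_itv//.
have E (a b : R) : a <= b -> leb `]a, b] = (b - a)%:E.
  move=> ab; rewrite lebesgue_measure_itv/= lte_fin; case: ltP => // h.
  by rewrite (_ : a = b) ?subrr//; apply/eqP; rewrite eq_le ab.
rewrite !E// -!EFinM; congr EFin; rewrite /box_intensity; ring.
Qed.
End intensity.

Lemma nneseries_mem_seq (R : realType) (s : seq nat) : uniq s ->
  (\sum_(i <oo | i \in s) (1 : \bar R) = (size s)%:R%:E)%E.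
Proof.
elim: s => [_|x s ih /= /andP[xs us]]; first by rewrite eseries_pred0.
rewrite (nneseriesD1 (n := x))//=; last by rewrite mem_head.
rewrite (eq_eseriesl (Q := mem s)).
  by rewrite ih// -EFinD -natr1 addrC.
by move=> i; rewrite !inE/=; case: eqVneq => //= [->|_]; rewrite ?andbT ?andbF// (negbTE xs).
Qed.

Section ppp.
Context d (Omega : measurableType d) (R : realType) (P : probability Omega R).
Notation mR := (measurableTypeR R).
Notation Mk := (mR * ((mR * mR) * mR))%type.
Notation leb := (@lebesgue_measure R).
Variables (lam0 : R) (FV fV : R -> R) (px py v th : nat -> Omega -> R).
Hypotheses (lam0_ge0 : 0 <= lam0) (fV_ge0 : forall y, 0 <= fV y)
  (fV_meas : measurable_fun setT fV)
  (fV_int1 : (\int[leb]_(y in setT) (fV y)%:E = 1)%E)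
  (FV_cdf : forall x, (FV x)%:E = (\int[leb]_(y in `]-oo, x]) (fV y)%:E)%E)
  (px_meas : forall i, measurable_fun setT (px i))
  (py_meas : forall i, measurable_fun setT (py i))
  (v_meas : forall i, measurable_fun setT (v i))
  (th_meas : forall i, measurable_fun setT (th i))
  (hPPP : marked_PPP px py v th P lam0 FV).

Definition station (i : nat) (w : Omega) : Mk := (v i w, ((px i w, py i w), th i w)).

Lemma measurable_station i : measurable_fun setT (station i).
Proof.
apply: measurable_fun_pair; first exact: v_meas.
apply: measurable_fun_pair; last exact: th_meas.
by apply: measurable_fun_pair; [exact: px_meas|exact: py_meas].
Qed.

Let measurable_station_preimage i A : measurable A -> measurable (station i @^-1` A).
Proof. by move=> mA; rewrite -[X in measurable X]setTI; exact: measurable_station. Qed.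

Local Notation Lam := (intensity lam0_ge0 fV_ge0 fV_meas fV_int1).

Let LamB (B : box R) : box_ok B -> Lam (box_set B) = (box_intensity lam0 FV B)%:E.
Proof. exact: intensity_box. Qed.

Lemma box_intensity_ge0 (B : box R) : box_ok B -> 0 <= box_intensity lam0 FV B.
Proof. by move=> Bok; rewrite -lee_fin -LamB. Qed.

(** Finite lists of indices are countably many, so the existential is a countable union; each [E s]
    fixes exactly which stations lie in [B]. *)
Lemma measurable_count_eq (B : box R) n : measurable (count_eq px py v th B n).
Proof.
pose E (s : seq nat) : set Omega := \bigcap_i (if i \in s then station i @^-1` box_set B
  else ~` (station i @^-1` box_set B)).
have mE s : measurable (E s).
  apply: bigcapT_measurable => i; case: ifP => _.
    by apply: measurable_station_preimage; exact: measurable_box_set.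
  by apply: measurableC; apply: measurable_station_preimage; exact: measurable_box_set.
rewrite (_ : count_eq _ _ _ _ _ _ = \bigcup_(s in [set s | uniq s /\ size s = n]) E s).
  rewrite bigcup_mkcond; apply: countable_bigcupT_measurable => [|s]; first exact: countableP.
    by case: ifP.
apply/seteqP; split => w /=.
  move=> [s [us [sn h]]]; exists s => // i _.
  by case: ifPn => [/h//|/negP si]; move=> /= /h.
move=> [s [us sn] h]; exists s; split => //; split => // i.
by have := h i I; case: ifPn => // /negP si; split.
Qed.

Let P_count_eq (B : box R) n : box_ok B ->
  P (count_eq px py v th B n) = (Defs.poisson_pmf (box_intensity lam0 FV B) n)%:E.
Proof.
move=> Bok; have := @hPPP 1 (fun=> B) (fun=> n) (fun=> Bok).
rewrite big_ord1 => <-; last by move=> j j'; rewrite !ord1.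
congr (P _); apply/seteqP; split => w /= h; first by move=> j _.
exact: (h ord0 I).
Qed.

(** Both sides are the expectation of the number [N] of stations in [B]. The Poisson weights sum to
    1, so the events [C n] exhaust the space up to a null set and an infinite count is
    negligible. *)
Lemma mean_count (B : box R) : box_ok B ->
  (\sum_(i <oo) P (station i @^-1` box_set B) = (box_intensity lam0 FV B)%:E)%E.
Proof.
move=> Bok; set m := box_intensity _ _ _; have m0 : 0 <= m := box_intensity_ge0 Bok.
pose F i := station i @^-1` box_set B.
have mF i : measurable (F i) by apply: measurable_station_preimage; exact: measurable_box_set.
pose N (w : Omega) : \bar R := (\sum_(i <oo) (\1_(F i) w)%:E)%E.
pose C n := count_eq px py v th B n.
have mC n : measurable (C n) := measurable_count_eq B n.
have N0 w : (0 <= N w)%E by apply: nneseries_ge0 => i _ _; rewrite lee_fin.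
have mi i : measurable_fun setT (fun w => (\1_(F i) w)%:E : \bar R).
  by apply/measurable_EFinP; exact: measurable_indic.
have mN : measurable_fun setT N.
  by apply: ge0_emeasurable_sum => // i w _ _; rewrite lee_fin.
have NC n w : C n w -> N w = n%:R%:E.
  move=> [s [us [sn h]]].
  transitivity (\sum_(i <oo | i \in s) (1 : \bar R))%E.
    rewrite [RHS]eseries_mkcond; apply: eq_eseriesr => i _.
    rewrite indicE; case: ifPn => si; first by rewrite mem_set//; apply/h.
    by rewrite memNset// => /h; rewrite (negbTE si).
  by rewrite nneseries_mem_seq// sn.
have tC : trivIset setT C.
  move=> i j _ _ [w [Ci Cj]]; have := NC _ _ Ci; rewrite (NC _ _ Cj) => -[] /eqP.
  by rewrite eqr_nat => /eqP.
have PC1 : P (\bigcup_n C n) = 1%E.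
  rewrite measure_bigcup// -(sum_poisson_pmf m0) (eq_eseriesl (Q := xpredT)).
    by apply: eq_eseriesr => n _; exact: P_count_eq.
  by move=> n; rewrite in_setT.
transitivity (\int[P]_w N w)%E.
  rewrite integral_nneseries//.
  by apply: eq_eseriesr => i _; rewrite integral_indic// setIT.
have mU : measurable (\bigcup_n C n) by exact: bigcupT_measurable.
rewrite (@ge0_negligible_integral _ _ _ P setT (~` \bigcup_n C n))//; last 2 first.
- exact: measurableC.
- by have := @probability_setC _ _ _ P _ mU; rewrite PC1 subee.
rewrite setTD setCK ge0_integral_bigcup//; last exact: measurable_funTS.
rewrite -(mean_poisson_pmf m0); apply: eq_eseriesr => n _.
rewrite -P_count_eq// -integral_cst//; apply: eq_integral => w /[!inE]; exact: NC.
Qed.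

Lemma count_eq0E (B : box R) :
  count_eq px py v th B 0 = [set w | forall i, ~ box_set B (station i w)].
Proof.
apply/seteqP; split => w /=.
  by move=> [s [_ [/size0nil -> h]]] i Bi; have := (h i).1 Bi.
by move=> h; exists [::]; split => //; split => // i; split => // /(h i).
Qed.

Let LamC n (c : grid_idx n) : Lam (cell c) = (box_intensity lam0 FV (grid_box R c))%:E.
Proof. by rewrite /cell LamB//; exact: grid_box_ok. Qed.

Lemma P_no_station_in n (A : {set grid_idx n}) :
  P (no_station_in station A) = (expR (- fine (Lam (cells A))))%:E.
Proof.
pose B (j : 'I_#|A|) : box R := grid_box R (enum_val j).
have -> : no_station_in station A = \bigcap_(j in [set: 'I_#|A|]) count_eq px py v th (B j) 0.
  apply/seteqP; split => w /=.
    by move=> h j _; rewrite count_eq0E => i; apply: h; exact: enum_valP.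
  move=> h i c cA; have := h (enum_rank_in cA c) I; rewrite count_eq0E.
  by move=> /(_ i); rewrite /B enum_rankK_in.
(* Distinct cells are disjoint, so the joint law applies with all counts 0, and the product of the
   exponentials is the exponential of the total mass. *)
have -> := @hPPP #|A| B (fun=> 0%N); last 2 first.
- by move=> j; exact: grid_box_ok.
- move=> j j' jj' x y v0 t0 b1 b2; move/eqP: jj'; apply.
  apply: enum_val_inj.
  exact: (@cell_inj R n _ _ (v0, ((x, y), t0))).
rewrite measure_cells.
rewrite (eq_bigr (fun c => (box_intensity lam0 FV (grid_box R c))%:E)); last by move=> c _; exact: LamC.
rewrite sumEFin/= -sumrN expR_sum; congr EFin.
rewrite [RHS]big_enum_val/=; apply: eq_bigr => j _.
by rewrite /Defs.poisson_pmf expr0 fact0 mulr1 divr1.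
Qed.

Let station_mixin i := isMeasurableFun.Build _ _ _ _ _ (measurable_station i).
Let station_mfun i : {mfun Omega >-> Mk} := HB.pack (station i) (station_mixin i).

(** The mean measure of the point process, packaged as a measure for the use of
    [le_measure_approx]. *)
Let Mean := mseries (fun i => distribution P (station_mfun i)) 0.

(* Only the means of boxes are known; open sets are exhausted by grid cells, and
   finiteness of the mean is all that Borel-Cantelli needs below. *)
Lemma mean_open_le (O : set (R * ((R * R) * R))) : open O -> measurable (O : set Mk) ->
  (\sum_(i <oo) P (station i @^-1` O) <= Lam O)%E.
Proof.
move=> oO mO.
apply: (@le_measure_approx _ _ _ Mean (fun n => @inner R n O) O) => //.
- by move=> n; exact: measurable_cells.
- by move=> m Om; apply: near_inner; exact: open_nbhs_nbhs.
move=> n; apply: (@le_trans _ _ (Lam (inner n O))); last first.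
  rewrite le_measure// ?inE//; first exact: measurable_cells.
  exact: innerS.
rewrite /inner !measure_cells; apply: lee_sum => c _.
rewrite le_eqVlt; apply/orP; left; apply/eqP.
exact: (etrans (mean_count (grid_box_ok R c)) (esym (LamC c))).
Qed.

Let D s (r : R) : set Mk := [set m | sqd s m < r].

Let open_D s r : open (D s r : set (R * ((R * R) * R))).
Proof.
rewrite (_ : D s r = @sqd R s @^-1` [set y | y < r])//.
by apply: open_comp => [m _|]; [exact: continuous_sqd|exact: open_lt].
Qed.

Let measurable_D s r : measurable (D s r).
Proof. exact: measurable_sqd_lt. Qed.

Definition nearest_station s i : set Omega := [set w | forall j, sqd s (station i w) <= sqd s (station j w)].

Lemma measurable_nearest_station s i : measurable (nearest_station s i).
Proof.
rewrite (_ : nearest_station s i = \bigcap_j [set w | sqd s (station i w) <= sqd s (station j w)]); last first.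
  by apply/seteqP; split => w h j; [move=> _|]; apply: h.
apply: bigcapT_measurable => j.
have m1 i' : measurable_fun setT (fun w => sqd s (station i' w)).
  exact: (measurableT_comp (@measurable_sqd R s) (measurable_station i')).
have := measurable_fun_ler (m1 i) (m1 j).
by move=> /(_ measurableT [set true]); rewrite setTI; exact.
Qed.

Lemma negligible_no_nearest s : (forall r : R, (Lam [set m : Mk | (sqd s m < r)%R] < +oo)%E) ->
  P (~` \bigcup_i nearest_station s i) = 0%E.
Proof.
move=> Dfin.
have mN : measurable (~` \bigcup_i nearest_station s i).
  by apply: measurableC; apply: bigcupT_measurable => i; exact: measurable_nearest_station.
apply/(negligibleP _ mN).
(* The radius needed below depends on [w]; integer radii keep the exceptional sets countable in
   number. *)
pose Z (n : nat) := lim_sup_set (fun i => station i @^-1` D s n%:R).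
have mZ n : measurable (Z n).
  apply: bigcapT_measurable => k; apply: bigcup_measurable => j _.
  by apply: measurable_station_preimage; exact: measurable_D.
apply: (@negligibleS _ _ _ _ (\bigcup_n Z n)); last first.
  apply: negligible_bigcup => n; apply/(negligibleP _ (mZ n)).
  apply: lim_sup_set_cvg0.
    by move=> k; apply: measurable_station_preimage; exact: measurable_D.
  apply: le_lt_trans (Dfin n%:R); apply: mean_open_le; [exact: open_D|exact: measurable_D].
move=> w /= nw; apply: contrapT => nZ; apply: nw.
pose r := Num.bound (sqd s (station 0 w)).
have r0 : sqd s (station 0 w) < r%:R by exact: unstable.ltr_bound.
have : ~ Z r w by move=> Zr; apply: nZ; exists r.
move=> /existsNP[n /not_implyP[_ hn]].
have far j : (n <= j)%N -> r%:R <= sqd s (station j w).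
  by move=> nj; rewrite leNgt; apply/negP => h; apply: hn; exists j.
(* Stations of index at least [n] are no closer than [r], hence farther than station 0; a minimum
   over the first [n.+1] indices is thus global. *)
pose i := [arg min_(i < (ord0 : 'I_n.+1)) sqd s (station i w)]%O.
have imin (j : 'I_n.+1) : sqd s (station i w) <= sqd s (station j w).
  by rewrite /i; case: arg_minP => // k _; apply.
exists (i : nat) => // j.
have [jn|jn] := ltnP j n.+1; first exact: (imin (Ordinal jn)).
by rewrite (le_trans (imin ord0))// (le_trans (ltW r0))// far// ltnW.
Qed.

Lemma nearestE h s i w : nearest px py v th h s i w <-> nearest_station s i w.
Proof.
have E j : dist_o px py v th h s j w = Num.sqrt (sqd s (station j w) + h ^+ 2) by [].
have sq0 j : 0 <= sqd s (station j w) by rewrite /sqd addr_ge0 ?sqr_ge0.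
split => H j; have := H j; rewrite !E ler_sqrt ?lerD2r//.
all: by rewrite addr_ge0 ?sqr_ge0.
Qed.
End ppp.

(** * The intensity of the beating region *)

Section disintegration.
Variables (R : realType) (lam : R) (f : R -> R).
Notation leb := (@lebesgue_measure R).
Notation mR := (measurableTypeR R).
Notation Mk := (mR * ((mR * mR) * mR))%type.
Hypotheses (lam0 : 0 <= lam) (f0 : forall x, 0 <= f x) (mf : measurable_fun setT f).
Hypothesis f1 : (\int[leb]_x (f x)%:E = 1)%E.
Local Notation PV := (pdf_prob f0 mf f1).
Local Notation unif := (@unif_angle R).
Local Notation pl := (@plane R).
Local Notation Lam := (intensity lam0 f0 mf f1).

Lemma ge0_integral_intensity (G : Mk -> \bar R) :
  measurable_fun setT G -> (forall m, 0 <= G m)%E ->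
  (\int[Lam]_m G m =
   lam%:E * \int[PV]_v \int[pl]_z \int[unif]_th G (v, (z, th)))%E.
Proof.
move=> mG G0.
have mGv v : measurable_fun setT (fun w => G (v, w)) by exact: measurableT_comp.
rewrite [LHS](@fubini_tonelli1 _ _ _ _ _ (mscale (NngNum lam0) PV) (@place R) G)//.
rewrite ge0_integral_mscale//; last 2 first.
- exact: measurable_fun_fubini_tonelli_F.
- by move=> v _; apply: integral_ge0.
congr (_ * _)%E; apply: eq_integral => v _.
exact: (@fubini_tonelli1 _ _ _ _ _ pl unif (fun w => G (v, w))).
Qed.

Lemma ge0_integral_plane_shift (F : mR * mR -> \bar R) (c : R * R) :
  measurable_fun setT F -> (forall z, 0 <= F z)%E ->
  (\int[pl]_z F (z.1 + c.1, z.2 + c.2)%R = \int[pl]_z F z)%E.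
Proof.
move=> mF F0.
have mFx x : measurable_fun setT (fun y => F (x, y)) by exact: measurableT_comp.
have mS : measurable_fun setT (fun z : mR * mR => (z.1 + c.1, z.2 + c.2)%R : mR * mR).
  apply: measurable_fun_pair; apply: measurable_funD => //.
have mI : measurable_fun setT (fun x : mR => \int[leb]_y F (x, y))%E.
  exact: (@measurable_fun_fubini_tonelli_F _ _ _ _ _ leb F mF F0).
pose I (x : mR) := (\int[leb]_y F (x, y))%E.
have I0 x : (0 <= I x)%E by apply: integral_ge0.
have -> : (\int[pl]_z F z = \int[leb]_x I x)%E.
  exact: (@fubini_tonelli1 _ _ _ _ _ leb leb F mF F0).
have -> : (\int[pl]_z F (z.1 + c.1, z.2 + c.2)%R =
    \int[leb]_x \int[leb]_y F (x + c.1, y + c.2)%R)%E.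
  exact: (@fubini_tonelli1 _ _ _ _ _ leb leb _ (measurableT_comp mF mS) (fun _ => F0 _)).
have <- := @ge0_integral_shift R c.1 I mI I0.
apply: eq_integral => x _.
exact: (@ge0_integral_shift _ c.2 (fun y => F ((x + c.1)%R, y)) (mFx _) (fun _ => F0 _)).
Qed.

(* Displacement: for a fixed velocity, Lebesgue measure is invariant under
   [z |-> z - t * velocity], so [z] is now the position at time [t]. *)
Lemma ge0_integral_intensity_displaced (t : R) (G : Mk -> \bar R) :
  measurable_fun setT G -> (forall m, 0 <= G m)%E ->
  (\int[Lam]_m G m =
   lam%:E * \int[PV]_v \int[pl]_z \int[unif]_th
     G (v, ((z.1 - t * v * cos th, z.2 - t * v * sin th)%R, th)))%E.
Proof.
move=> mG G0.
have ms := @measurable_sin R; have mc := @measurable_cos R.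
apply: (etrans (ge0_integral_intensity mG G0)).
apply: (congr1 (fun x => lam%:E * x)%E).
apply: eq_integral => v _.
have mGv : measurable_fun setT (fun w => G (v, w)) by exact: measurableT_comp.
have mGz : measurable_fun setT (fun w : (mR * mR) * mR =>
    G (v, ((w.1.1 - t * v * cos w.2, w.1.2 - t * v * sin w.2)%R, w.2))).
  apply: (measurableT_comp mGv); apply: measurable_fun_pair => //.
  apply: measurable_fun_pair; apply: measurable_funB.
  - exact: measurableT_comp.
  - by apply: measurable_funM => //; apply: (measurableT_comp mc).
  - exact: measurableT_comp.
  - by apply: measurable_funM => //; apply: (measurableT_comp ms).
(* The displacement depends on [th], so [th] is made the outer variable while [z] is translated, and
   the order is restored afterwards. *)
apply: (etrans (@fubini_tonelli _ _ _ _ _ pl unif (fun w => G (v, w)) mGv (fun _ => G0 _))).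
apply: (etrans _ (esym (@fubini_tonelli _ _ _ _ _ pl unif (fun w : (mR * mR) * mR =>
  G (v, ((w.1.1 - t * v * cos w.2, w.1.2 - t * v * sin w.2)%R, w.2))) mGz (fun _ => G0 _)))).
apply: eq_integral => th _.
have mGth : measurable_fun setT (fun z : mR * mR => G (v, (z, th))).
  by apply: (measurableT_comp mGv); apply: measurable_fun_pair.
exact: esym (@ge0_integral_plane_shift (fun z => G (v, (z, th)))
  (- (t * v * cos th), - (t * v * sin th)) mGth (fun _ => G0 _)).
Qed.

Lemma enorm_sqr (z : R * R) : enorm z ^+ 2 = z.1 ^+ 2 + z.2 ^+ 2.
Proof. by rewrite sqr_sqrtr// addr_ge0 ?sqr_ge0. Qed.

(** By the law of cosines the left integrand depends on [th] through [cos (th - phi)], [phi] being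
    the polar angle of [z]; a uniform direction absorbs [phi]. *)
Lemma ge0_integral_rotate (g : R -> \bar R) (z : R * R) (a : R) :
  measurable_fun setT g -> (forall x, 0 <= g x)%E ->
  (\int[unif]_th g ((z.1 + a * cos th) ^+ 2 + (z.2 + a * sin th) ^+ 2)%R =
   \int[unif]_th g (enorm z ^+ 2 + a ^+ 2 + 2 * enorm z * a * cos th)%R)%E.
Proof.
move=> mg g0.
have [phi [phi0 zx zy]] := polar_angle z.
have mgc (b c : R) : measurable_fun setT (fun x : mR => g (b + c * x)%R).
  by apply: (measurableT_comp mg); apply: measurable_funD => //; exact: measurable_funM.
rewrite integral_uniform//; last first.
  apply: (measurableT_comp mg); apply: measurable_funD; apply: measurable_funX;
    apply: measurable_funD => //; apply: measurable_funM => //.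
    exact: measurable_cos.
  exact: measurable_sin.
pose gc (x : R) := g (enorm z ^+ 2 + a ^+ 2 + 2 * enorm z * a * x).
have mgc' : measurable_fun setT gc by exact: mgc.
rewrite [RHS](integral_uniform _ (measurableT_comp mgc' (@measurable_cos R)) (fun _ => g0 _)).
congr (_ * _)%E.
apply: etrans (ge0_integral_cos_shift mgc' (fun _ => g0 _) phi0).
apply: eq_integral => th _; congr g.
rewrite zx zy cosB.
have := cos2Dsin2 phi; have := cos2Dsin2 th.
move: (enorm z) (cos phi) (sin phi) (cos th) (sin th) => e cp sp ct st h1 h2.
(* The squares are homogenised by [cos ^+ 2 + sin ^+ 2 = 1], after which the identity is
   polynomial. *)
have -> : e ^+ 2 = e ^+ 2 * (cp ^+ 2 + sp ^+ 2) by rewrite h2 mulr1.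
have -> : a ^+ 2 = a ^+ 2 * (ct ^+ 2 + st ^+ 2) by rewrite h1 mulr1.
ring.
Qed.

(** A shift by [pi]. It reconciles the displacement, which produces [+ 2 * u * v * t * cos th], with
    the minus sign in the [R] of the theorem. *)
Lemma ge0_integral_cosN (g : R -> \bar R) :
  measurable_fun setT g -> (forall x, 0 <= g x)%E ->
  (\int[unif]_th g (cos th) = \int[unif]_th g (- cos th)%R)%E.
Proof.
move=> mg g0.
have mN : measurable_fun setT (fun x : R => - cos x).
  by apply: measurable_funN; exact: measurable_cos.
apply: etrans (integral_uniform _ (measurableT_comp mg (@measurable_cos R)) (fun _ => g0 _)) _.
apply: etrans _ (esym (integral_uniform _ (measurableT_comp mg mN) (fun _ => g0 _))).
congr (_ * _)%E; have p0 := pi_ge0 R.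
have p2 : 0 <= (pi : R) <= 2 * pi by apply/andP; lra.
apply: etrans (esym (ge0_integral_cos_shift mg g0 p2)) _.
by apply: eq_integral => th _ /=; rewrite cosB cospi sinpi mulrN1 mulr0 addr0.
Qed.

End disintegration.

Section regions.
Variables (R : realType) (lam : R) (f : R -> R).
Notation leb := (@lebesgue_measure R).
Notation mR := (measurableTypeR R).
Notation Mk := (mR * ((mR * mR) * mR))%type.
Hypotheses (lam0 : 0 <= lam) (f0 : forall x, 0 <= f x) (mf : measurable_fun setT f).
Hypothesis f1 : (\int[leb]_x (f x)%:E = 1)%E.
Local Notation PV := (pdf_prob f0 mf f1).
Local Notation unif := (@unif_angle R).
Local Notation pl := (@plane R).
Local Notation Lam := (intensity lam0 f0 mf f1).

Let PV_cst (c : R) : (\int[PV]_v c%:E = c%:E)%E.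
Proof.
apply: (etrans (@integral_cst _ _ _ PV setT measurableT c%:E)).
by apply: etrans (congr1 (fun x => c%:E * x)%E (f1 : PV setT = 1%E)) _; rewrite mule1.
Qed.

Let unif_cst (c : R) : (\int[unif]_th c%:E = c%:E)%E.
Proof.
apply: (etrans (@integral_cst _ _ _ unif setT measurableT c%:E)).
have u1 : unif setT = 1%E := probability_setT (uniform_prob (@pi2_gt0 R)).
by apply: etrans (congr1 (fun x => c%:E * x)%E u1) _; rewrite mule1.
Qed.

Lemma sqd_displaced s v (z : R * R) th :
  sqd s (v, ((z.1 - s * v * cos th, z.2 - s * v * sin th), th)) = z.1 ^+ 2 + z.2 ^+ 2.
Proof. by rewrite /sqd/= !subrK. Qed.

(** Independent displacements preserve a homogeneous planar density: after the change of variables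
    [sqd s] no longer involves speed or direction. *)
Lemma intensity_disk s (b : R) : 0 <= b ->
  Lam [set m | sqd s m < b ^+ 2] = (lam * (pi * b ^+ 2))%:E.
Proof.
move=> b0; set S := [set m | _]; have mS : measurable S by exact: measurable_sqd_lt.
have m1S : measurable_fun setT (fun m : Mk => (\1_S m)%:E : \bar R).
  by apply/measurable_EFinP; exact: measurable_indic.
have S0 m : (0 <= (\1_S m)%:E :> \bar R)%E by rewrite lee_fin.
have -> : (Lam S = \int[Lam]_m (\1_S m)%:E)%E by rewrite (integral_indic Lam measurableT mS) setIT.
apply: (etrans (ge0_integral_intensity_displaced lam0 f0 mf f1 s m1S S0)).
rewrite [RHS]EFinM; apply: (congr1 (fun x => lam%:E * x)%E).
transitivity (\int[PV]_v (pi * b ^+ 2)%:E)%E; last exact: PV_cst.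
apply: eq_integral => v _.
transitivity (\int[pl]_z (\1_([set z : mR * mR | enorm z < b]) z)%:E)%E.
  apply: eq_integral => z _.
  transitivity (\int[unif]_th (\1_([set z : mR * mR | enorm z < b]) z)%:E)%E; last exact: unif_cst.
  apply: eq_integral => th _; congr (_%:E); rewrite !indicE; congr (_%:R); congr nat_of_bool.
  apply/idP/idP; rewrite !inE /S/= sqd_displaced -enorm_sqr => h.
    by rewrite -(@ltr_pXn2r _ 2) ?nnegrE ?sqrtr_ge0.
  by rewrite ltr_pXn2r ?nnegrE ?sqrtr_ge0.
rewrite integral_indic//; first by rewrite setIT; exact: disk_area.
have := @measurable_fun_ltr _ _ _ setT _ (cst b) (@measurable_enorm R) (measurable_cst b).
by move=> /(_ measurableT [set true]); rewrite setTI; exact.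
Qed.

Variable t : R.
Definition at_least (c x : R) : \bar R := (\1_(`[c, +oo[%classic : set R) x)%:E.

Let measurable_at_least c : measurable_fun setT (at_least c).
Proof. by apply/measurable_EFinP; apply: measurable_indic. Qed.

Let at_least_ge0 c x : (0 <= at_least c x)%E.
Proof. by rewrite lee_fin. Qed.

(* Probability that a station of speed [v] seen at distance [s] at time [t] was
   at distance at least [u] at time 0. *)
Definition escape (u s v : R) : \bar R :=
  (\int[unif]_th at_least (u ^+ 2) (s ^+ 2 + (- (t * v)) ^+ 2 + 2 * s * (- (t * v)) * cos th)%R)%E.

Lemma escape_ge0 u s v : (0 <= escape u s v)%E.
Proof. by apply: integral_ge0. Qed.

Lemma measurable_escape u : measurable_fun setT (fun vs : mR * mR => escape u vs.2 vs.1).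
Proof.
pose g (w : (mR * mR) * mR) : \bar R := at_least (u ^+ 2)
  (w.1.2 ^+ 2 + (- (t * w.1.1)) ^+ 2 + 2 * w.1.2 * (- (t * w.1.1)) * cos w.2).
have m1 : measurable_fun setT (fun w : (mR * mR) * mR => w.1.1).
  exact: (measurableT_comp measurable_fst measurable_fst).
have m2 : measurable_fun setT (fun w : (mR * mR) * mR => w.1.2).
  exact: (measurableT_comp measurable_snd measurable_fst).
have m3 : measurable_fun setT (fun w : (mR * mR) * mR => cos w.2).
  exact: (measurableT_comp (@measurable_cos R) measurable_snd).
have mtv : measurable_fun setT (fun w : (mR * mR) * mR => - (t * w.1.1)).
  by apply: measurable_funN; exact: measurable_funM.
have mg : measurable_fun setT g.
  apply: (measurableT_comp (@measurable_at_least (u ^+ 2))).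
  apply: measurable_funD; first by apply: measurable_funD; apply: measurable_funX.
  by apply: measurable_funM => //; apply: measurable_funM => //; exact: measurable_funM.
exact: (@measurable_fun_fubini_tonelli_F _ _ _ _ _ unif g mg (fun _ => at_least_ge0 _ _)).
Qed.

(** Polar density of the disk of radius [r], extended by 0 so that Tonelli runs over the whole
    line. *)
Definition shell (r s : R) : R := if 0 <= s < r then 2 * pi * s else 0.

Lemma shell_ge0 r s : 0 <= shell r s.
Proof. by rewrite /shell; case: ifP => // /andP[s0 _]; rewrite !mulr_ge0// pi_ge0. Qed.

Lemma measurable_shell r : measurable_fun setT (shell r : mR -> mR).
Proof.
apply: measurable_fun_if => //.
by apply: measurable_and; [exact: measurable_fun_ler|exact: measurable_fun_ltr].
Qed.

Lemma intensity_annulus (u r : R) : 0 <= r ->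
  Lam [set m | u ^+ 2 <= sqd 0 m /\ sqd t m < r ^+ 2] =
  (lam%:E * \int[leb]_s ((shell r s)%:E * \int[PV]_v escape u s v))%E.
Proof.
move=> r0; set S := [set m | _].
have mS : measurable S.
  rewrite (_ : S = ~` [set m | sqd 0 m < u ^+ 2] `&` [set m | sqd t m < r ^+ 2]).
    by apply: measurableI; [apply: measurableC|]; exact: measurable_sqd_lt.
  by apply/seteqP; split => m /= [h1 h2]; split => //;
    [apply/negP; rewrite -leNgt|rewrite leNgt; apply/negP].
have m1S : measurable_fun setT (fun m : Mk => (\1_S m)%:E : \bar R).
  by apply/measurable_EFinP; exact: measurable_indic.
have S0 m : (0 <= (\1_S m)%:E :> \bar R)%E by rewrite lee_fin.
have -> : (Lam S = \int[Lam]_m (\1_S m)%:E)%E by rewrite (integral_indic Lam measurableT mS) setIT.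
apply: (etrans (ge0_integral_intensity_displaced lam0 f0 mf f1 t m1S S0)).
apply: (congr1 (fun x => lam%:E * x)%E).
have mQ v : measurable_fun setT (fun s : mR => escape u s v).
  have mp : measurable_fun setT (fun s : mR => (v, s) : mR * mR) by apply: measurable_fun_pair.
  exact: (measurableT_comp (@measurable_escape u) mp).
have mQ' s : measurable_fun setT (fun v : mR => escape u s v).
  have mp : measurable_fun setT (fun v : mR => (v, s) : mR * mR) by apply: measurable_fun_pair.
  exact: (measurableT_comp (@measurable_escape u) mp).
have mi : measurable_fun setT (fun s : mR => (\1_(`]-oo, r[%classic : set R) s)%:E : \bar R).
  by apply/measurable_EFinP; apply: measurable_indic.
transitivity (\int[PV]_v \int[leb]_s ((shell r s)%:E * escape u s v))%E.
  apply: eq_integral => v _.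
  pose g (s : R) : \bar R := ((\1_(`]-oo, r[%classic : set R) s)%:E * escape u s v)%E.
  have mg : measurable_fun setT g by apply: emeasurable_funM => //; exact: mQ.
  have g0 s : (0 <= g s)%E by rewrite mule_ge0 ?escape_ge0// lee_fin.
  transitivity (\int[pl]_z g (enorm z))%E.
    apply: eq_integral => z _.
    (* Here [z] is the position at time [t]; going back to time 0 displaces it by [- (t * v)] along
       the direction. *)
    rewrite /g -[escape u _ v](@ge0_integral_rotate _ (at_least (u ^+ 2)) z (- (t * v)))//.
    have mrot : measurable_fun setT (fun th : mR => at_least (u ^+ 2)
        ((z.1 + - (t * v) * cos th) ^+ 2 + (z.2 + - (t * v) * sin th) ^+ 2)).
      apply: (measurableT_comp (@measurable_at_least (u ^+ 2))).
      apply: measurable_funD; apply: measurable_funX; apply: measurable_funD => //;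
        apply: measurable_funM => //; [exact: measurable_cos|exact: measurable_sin].
    have c0 : (0 <= (\1_(`]-oo, r[%classic : set R) (enorm z))%:E :> \bar R)%E by rewrite lee_fin.
    apply: (etrans _ (@ge0_integralZl _ _ _ unif setT measurableT _ mrot _ (fun _ _ => at_least_ge0 _ _) c0)).
    apply: eq_integral => th _; rewrite -EFinM; congr (_%:E).
    rewrite !indicE /=.
    have -> : ((v, ((z.1 - t * v * cos th, z.2 - t * v * sin th), th)) \in S) =
      (enorm z \in (`]-oo, r[%classic : set R)) &&
      (((z.1 + - (t * v) * cos th) ^+ 2 + (z.2 + - (t * v) * sin th) ^+ 2) \in (`[u ^+ 2, +oo[%classic : set R)).
      rewrite !mem_setE !in_itv/= andbT; apply/idP/idP; rewrite inE /S/= sqd_displaced -enorm_sqr.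
        rewrite {1}/sqd/= !mul0r !addr0 !mulNr => -[-> h]; rewrite andbT.
        by rewrite -(@ltr_pXn2r _ 2) ?nnegrE ?sqrtr_ge0.
      move=> /andP[h1 h2]; rewrite {1}/sqd/= !mul0r !addr0; rewrite !mulNr in h2.
      by split => //; rewrite ltr_pXn2r ?nnegrE ?sqrtr_ge0.
    by case: (_ \in _); case: (_ \in _); rewrite ?mulr0 ?mulr1 ?mul0r.
  apply: (etrans (ge0_integral_polar mg g0)).
  rewrite integral_mkcond; apply: eq_integral => s _.
  rewrite patchE /shell /g mem_setE in_itv/= andbT indicE mem_setE in_itv/=.
  by case: (0 <= s) => /=; case: (s < r); rewrite ?mul1e ?mul0e ?mule0.
pose h (vs : mR * mR) : \bar R := ((shell r vs.2)%:E * escape u vs.2 vs.1)%E.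
have mh : measurable_fun setT h.
  apply: emeasurable_funM; last exact: measurable_escape.
  by apply/measurable_EFinP; exact: (measurableT_comp (@measurable_shell r) measurable_snd).
have h0 vs : (0 <= h vs)%E by rewrite mule_ge0 ?escape_ge0// lee_fin shell_ge0.
(* With the speed innermost, the inner integral is the one that [integral_escape] evaluates. *)
apply: (etrans (@fubini_tonelli _ _ _ _ _ PV leb h mh h0)).
apply: eq_integral => s _.
have Ws0 : (0 <= (shell r s)%:E)%E by rewrite lee_fin shell_ge0.
exact: (@ge0_integralZl _ _ _ PV setT measurableT _ (mQ' s) _ (fun _ _ => escape_ge0 _ _ _) Ws0).
Qed.
End regions.

(** The two points will be the speeds [(u - s) / t] and 0, where [captured] may miss the true
    probability. *)
Lemma measurable_fun_eq_except2 (R : realType) (g k : R -> R) (a b : R) :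
  measurable_fun setT g -> (forall x, x != a -> x != b -> k x = g x) ->
  measurable_fun setT k.
Proof.
move=> mg kg.
have -> : k = fun x => if x == a then k a else if x == b then k b else g x.
  apply/funext => x; case: eqVneq => [->//|xa]; case: eqVneq => [->//|xb].
  exact: kg.
apply: measurable_fun_if => //; first exact: measurable_fun_eqr.
apply: measurable_funTS; apply: measurable_fun_if => //; first exact: measurable_fun_eqr.
exact: measurable_funTS.
Qed.

Lemma ge0_integral_eq_except2 (R : realType) (g k : R -> R) (a b : R) :
  measurable_fun setT g -> (forall x, 0 <= g x) -> (forall x, 0 <= k x) ->
  (forall x, x != a -> x != b -> k x = g x) ->
  (\int[@lebesgue_measure R]_x (k x)%:E = \int[@lebesgue_measure R]_x (g x)%:E)%E.
Proof.
move=> mg g0 k0 kg; apply: ge0_ae_eq_integral => //.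
- by apply/measurable_EFinP; exact: measurable_fun_eq_except2 mg kg.
- exact/measurable_EFinP.
- by move=> x _; rewrite lee_fin.
- by move=> x _; rewrite lee_fin.
exists ([set a] `|` [set b]); split.
- by apply: measurableU; exact: measurable_set1.
- apply/eqP; rewrite eq_le measure_ge0 andbT.
  apply: (le_trans (measureU2 _ _ _)); [exact: measurable_set1|exact: measurable_set1|].
  have h0 : (@lebesgue_measure R [set a] + @lebesgue_measure R [set b] <= 0)%E.
    by rewrite !lebesgue_measure_set1 adde0.
  exact: h0.
move=> x /= h; apply: contrapT => /not_orP[/eqP xa /eqP xb]; apply: h => _.
by rewrite kg.
Qed.

(** * The thinning probability as an angle *)

Section thinning.
Variables (R : realType) (t : R).
Notation leb := (@lebesgue_measure R).
Notation mR := (measurableTypeR R).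
Local Notation unif := (@unif_angle R).
Hypothesis t0 : 0 < t.

(** Law of cosines: in a triangle with sides [v * t], [s] and [u], the cosine of the angle opposite
    to [u]. *)
Definition kappa (u s v : R) : R := (v ^+ 2 * t ^+ 2 + s ^+ 2 - u ^+ 2) / (2 * v * t * s).

(* Value of [1 - escape t u s v] in the form of the theorem; wrong (but harmless) at
   [v = (u - s) / t], where both terms count, and at [v = 0], where [kappa] is [x / 0 = 0]. *)
Definition captured (u s v : R) : R :=
  (if v <= (u - s) / t then 1 else 0) +
  (if `|u - s| / t <= v <= (u + s) / t then pi^-1 * acos (kappa u s v) else 0).

(** The bounds on [v] are the triangle inequalities for [v * t], [s] and [u]. *)
Lemma kappa_itv u s v : 0 < u -> 0 < s -> `|u - s| / t <= v <= (u + s) / t ->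
  -1 <= kappa u s v <= 1.
Proof.
move=> u0 s0; rewrite ler_pdivrMr// ler_pdivlMr// => /andP[h1 h2].
have vt0 : 0 <= v * t by apply: le_trans h1.
(* The degenerate triangle divides by 0, which gives the value 0. *)
have [vt|vt] := eqVneq (v * t) 0.
  by rewrite /kappa -[2 * v * t]mulrA vt mulr0 mul0r invr0 mulr0 lerN10 ler01.
have vtp : 0 < v * t by rewrite lt_neqAle eq_sym vt.
move: h1; rewrite ler_norml => /andP[h1 h3].
rewrite /kappa -exprMn -[2 * v * t]mulrA; move: (v * t) h1 h2 h3 vt0 vtp {vt} => w h1 h2 h3 vt0 vtp.
have d0 : 0 < 2 * w * s by rewrite !mulr_gt0.
rewrite ler_pdivlMr// ler_pdivrMr// mulN1r mul1r; apply/andP; split; nra.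
Qed.

Lemma captured_ge0 u s v : 0 < u -> 0 < s -> 0 <= captured u s v.
Proof.
move=> u0 s0; apply: addr_ge0; first by case: ifP.
case: ifPn => // h; rewrite mulr_ge0 ?invr_ge0 ?pi_ge0//.
exact: acos_ge0 (kappa_itv u0 s0 h).
Qed.

Lemma unif_angle_all (A : set mR) : (forall th, A th) -> unif A = 1%E.
Proof.
move=> h; rewrite (_ : A = setT); last by apply/seteqP; split.
exact: (probability_setT (uniform_prob (@pi2_gt0 R))).
Qed.

Lemma unif_angle_cos_gt c : -1 <= c <= 1 ->
  unif [set th : mR | c < cos th] = (pi^-1 * acos c)%:E.
Proof.
move=> c1; rewrite /unif_angle /uniform_prob integral_uniform_pdf.
have p0 := @pi2_gt0 R; have pi0 := pi_gt0 R.
have mc : measurable [set th : mR | c < cos th].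
  have := @measurable_fun_ltr _ _ _ setT (cst c) _ (measurable_cst c) (@measurable_cos R).
  by move=> /(_ measurableT [set true]); rewrite setTI; exact.
transitivity (\int[leb]_(x in [set th : mR | (c < cos th)%R] `&` `[0%R, (2 * pi)%R]) ((2 * pi)^-1)%:E)%E.
  apply: eq_integral => x; rewrite inE => -[_ /=]; rewrite in_itv/= => x0.
  by rewrite /uniform_pdf x0 subr0.
rewrite integral_cst; last exact: measurableI.
apply: (etrans (congr1 (fun x => ((2 * pi)^-1)%:E * x)%E (lebesgue_measure_cos_gt c1))).
by rewrite -EFinM; congr EFin; rewrite invfM mulrACA mulVf ?mul1r// pnatr_eq0.
Qed.

Definition angle_in (u s v : R) : set mR :=
  [set th | s ^+ 2 + (- (t * v)) ^+ 2 + 2 * s * (- (t * v)) * cos th < u ^+ 2].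

(** The squared distance at time 0 lies between [(s - t * v) ^+ 2] and [(s + t * v) ^+ 2]. If
    [t * v < u - s] every direction qualifies, if the triangle inequalities hold those with cosine
    above [kappa] do, and otherwise none does. *)
Lemma unif_angle_in u s v : 0 < u -> 0 < s -> 0 < v -> v != (u - s) / t ->
  unif (angle_in u s v) = (captured u s v)%:E.
Proof.
move=> u0 s0 v0 va; have w0 : 0 < t * v by rewrite mulr_gt0.
have E x : (x / t <= v) = (x <= t * v) by rewrite ler_pdivrMr// mulrC.
have E' x : (v <= x / t) = (t * v <= x) by rewrite ler_pdivlMr// mulrC.
have wa : t * v != u - s.
  by apply: contraNneq va => <-; rewrite [t * v]mulrC mulfK// gt_eqF.
rewrite /captured E' E E' /angle_in.
have [h|h] := leP (t * v) (u - s).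
  have h' : t * v < u - s by rewrite lt_neqAle wa.
  rewrite ger0_norm; last lra.
  rewrite leNgt h'/= addr0; apply: unif_angle_all => th /=.
  have := cos_geN1 th; move: (cos th) (t * v) w0 h' => c w w0 h' c1.
  have : 0 <= (c + 1) * (2 * s * w) by rewrite !mulr_ge0; lra.
  nra.
rewrite add0r; case: ifPn => [/andP[h1 h2]|].
  have hk : -1 <= kappa u s v <= 1 by apply: kappa_itv => //; rewrite E E' h1.
  rewrite -unif_angle_cos_gt//; congr (unif _); apply/seteqP.
  have d0 : 0 < 2 * v * t * s by rewrite !mulr_gt0.
  by split => th /=; rewrite /kappa ltr_pdivrMr//; nra.
rewrite negb_and -!ltNge => hout.
have -> : [set th : mR | s ^+ 2 + (- (t * v)) ^+ 2 + 2 * s * (- (t * v)) * cos th < u ^+ 2] = set0.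
  apply/seteqP; split => // th /=; apply/negP; rewrite -leNgt.
  have := cos_le1 th; move: (cos th) (t * v) w0 h hout {wa} => c w w0 h hout c1.
  have : 0 <= (1 - c) * (2 * s * w) by rewrite !mulr_ge0; lra.
  suff : u ^+ 2 <= (s - w) ^+ 2 by nra.
  case/orP: hout => h1.
    have : w < s - u by move: h1; rewrite ltr_normr => /orP[]; lra.
    nra.
  nra.
exact: measure0.
Qed.

End thinning.

Section region_measure.
Variables (R : realType) (lam : R) (f F : R -> R) (t : R).
Notation leb := (@lebesgue_measure R).
Notation mR := (measurableTypeR R).
Notation Mk := (mR * ((mR * mR) * mR))%type.
Hypotheses (lam0 : 0 <= lam) (f0 : forall x, 0 <= f x) (mf : measurable_fun setT f).
Hypothesis f_neg : forall y, y < 0 -> f y = 0.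
Hypothesis f1 : (\int[leb]_x (f x)%:E = 1)%E.
Hypothesis F_cdf : forall x, (F x)%:E = (\int[leb]_(y in `]-oo, x]) (f y)%:E)%E.
Hypothesis t0 : 0 < t.
Local Notation PV := (pdf_prob f0 mf f1).
Local Notation unif := (@unif_angle R).
Local Notation Lam := (intensity lam0 f0 mf f1).

Lemma measurable_escape1 u s : measurable_fun setT (fun v : mR => escape t u s v).
Proof.
have mp : measurable_fun setT (fun v : mR => (v, s) : mR * mR) by apply: measurable_fun_pair.
exact: (measurableT_comp (@measurable_escape R t u) mp).
Qed.

Lemma measurable_angle_in u s v : measurable (angle_in t u s v).
Proof.
have m1 : measurable_fun setT (fun th : mR => s ^+ 2 + (- (t * v)) ^+ 2 + 2 * s * (- (t * v)) * cos th).
  by apply: measurable_funD => //; apply: measurable_funM => //; exact: measurable_cos.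
have := @measurable_fun_ltr _ _ _ setT _ (cst (u ^+ 2)) m1 (measurable_cst _).
by move=> /(_ measurableT [set true]); rewrite setTI; exact.
Qed.

Lemma escapeE u s v : escape t u s v = (1 - unif (angle_in t u s v))%E.
Proof.
have mA := measurable_angle_in u s v.
apply: (etrans _ (@probability_setC _ _ _ (uniform_prob (@pi2_gt0 R)) _ mA)).
transitivity (\int[unif]_th (\1_(~` angle_in t u s v) th)%:E)%E.
  apply: eq_integral => th _; rewrite /at_least !indicE; congr (_%:R%:E); congr nat_of_bool.
  apply/idP/idP; rewrite !inE/= in_itv/= andbT /angle_in/=.
    by move=> h; apply/negP; rewrite -leNgt.
  by move=> /negP; rewrite -leNgt.
exact: (etrans (integral_indic unif measurableT (measurableC mA)) (congr1 unif (setIT _))).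
Qed.

(** The true capture probability, measurable in [v] through [escape]; the integrand with [captured]
    inherits this by agreement off two points. *)
Let g u s v : R := fine (unif (angle_in t u s v)).

Let gE u s v : unif (angle_in t u s v) = (g u s v)%:E.
Proof.
by rewrite /g fineK//; apply: fin_num_measure; exact: measurable_angle_in.
Qed.

Let g0 u s v : 0 <= g u s v.
Proof. by rewrite /g fine_ge0. Qed.

Let mg u s : measurable_fun setT (g u s : mR -> mR).
Proof.
have -> : g u s = fun v => 1 - fine (escape t u s v).
  by apply/funext => v; rewrite escapeE gE/= opprB addrCA subrr addr0.
by apply: measurable_funB => //; apply: measurableT_comp => //; exact: measurable_escape1.
Qed.

Let k u s v : R := f v * (pi^-1 * acos ((v ^+ 2 * t ^+ 2 + s ^+ 2 - u ^+ 2) / (2 * v * t * s))).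

Lemma integral_captured u s : 0 < u -> 0 < s ->
  (\int[leb]_v (f v * captured t u s v)%:E =
   (F ((u - s) / t)%R)%:E + \int[leb]_(v in `[(`|u - s| / t)%R, ((u + s) / t)%R]) (k u s v)%:E)%E.
Proof.
move=> u0 s0; pose a := (u - s) / t; pose b := (u + s) / t; pose c := `|u - s| / t.
pose p v := if v <= a then f v else 0.
pose q v := if c <= v <= b then k u s v else 0.
have mp : measurable_fun setT (p : mR -> mR).
  apply: measurable_fun_if => //; first exact: measurable_fun_ler.
  exact: measurable_funTS.
have mfg : measurable_fun setT (fun v : mR => f v * captured t u s v).
  apply: (@measurable_fun_eq_except2 R (fun v => f v * g u s v) _ a 0).
    by apply: measurable_funM => //; exact: mg.
  move=> v va v0; have [vneg|vpos] := ltP v 0; first by rewrite f_neg ?mul0r.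
  congr (_ * _); apply: EFin_inj; rewrite -gE unif_angle_in//.
  by rewrite lt_neqAle eq_sym v0.
have pq v : f v * captured t u s v = p v + q v.
  by rewrite /captured mulrDr /p /q /k /kappa; congr (_ + _); case: ifP; rewrite ?mulr1 ?mulr0.
(* The part with [acos] is obtained as a difference of two functions already known to be
   measurable. *)
have mq : measurable_fun setT (q : mR -> mR).
  have -> : q = fun v => f v * captured t u s v - p v.
    by apply/funext => v; rewrite pq addrC addKr.
  exact: measurable_funB.
have p0 v : 0 <= p v by rewrite /p; case: ifP.
have q0 v : 0 <= q v.
  rewrite /q; case: ifPn => // h; rewrite /k !mulr_ge0 ?invr_ge0 ?pi_ge0//.
  exact: acos_ge0 (kappa_itv t0 u0 s0 h).
transitivity (\int[leb]_v ((p v)%:E + (q v)%:E))%E.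
  by apply: eq_integral => v _; rewrite pq EFinD.
rewrite ge0_integralD//; [|by move=> v _; rewrite lee_fin|exact/measurable_EFinP|by move=> v _; rewrite lee_fin|exact/measurable_EFinP].
congr (_ + _)%E.
  rewrite F_cdf [RHS]integral_mkcond; apply: eq_integral => v _.
  by rewrite patchE mem_setE in_itv/= /p; case: ifP.
rewrite [RHS]integral_mkcond; apply: eq_integral => v _.
by rewrite patchE mem_setE in_itv/= /q; case: ifP.
Qed.

(** Escape and capture probabilities add up to 1. Captured mass comes from the speeds at which every
    direction is captured, the cdf term, and from those at which an arc of directions is, the [acos]
    term. *)
Lemma integral_escape u s : 0 < u -> 0 < s ->
  (lam%:E * \int[PV]_v escape t u s v = (lam_thin lam F f t s u)%:E)%E.
Proof.
move=> u0 s0.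
have mgE : measurable_fun setT (fun v : mR => (g u s v)%:E : \bar R).
  by apply/measurable_EFinP; exact: mg.
have e0 v : (0 <= escape t u s v)%E := escape_ge0 t u s v.
have tot : (\int[PV]_v escape t u s v + \int[PV]_v (g u s v)%:E = 1)%E.
  rewrite -ge0_integralD//; last 2 first.
  - exact: measurable_escape1.
  - by move=> v _; rewrite lee_fin.
  transitivity (\int[PV]_v (1%:E : \bar R))%E.
    by apply: eq_integral => v _; rewrite escapeE gE -EFinB -EFinD subrK.
  apply: etrans (integral_cst PV measurableT 1%:E) _.
  by apply: etrans (congr1 (fun x => 1%:E * x)%E (f1 : PV setT = 1%E)) _; rewrite mule1.
have cap : (\int[PV]_v (g u s v)%:E = (F ((u - s) / t)%R)%:E +
    \int[leb]_(v in `[(`|u - s| / t)%R, ((u + s) / t)%R]) (k u s v)%:E)%E.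
  rewrite -integral_captured//.
  apply: (etrans (ge0_integral_dens leb f0 mf mgE _)); first by move=> v; rewrite lee_fin.
  transitivity (\int[leb]_v (f v * g u s v)%:E)%E.
    by apply: eq_integral => v _; rewrite EFinM.
  apply/esym/(@ge0_integral_eq_except2 R _ _ ((u - s) / t) 0).
  - by apply: measurable_funM => //; exact: mg.
  - by move=> v; rewrite mulr_ge0.
  - by move=> v; rewrite mulr_ge0// captured_ge0.
  move=> v va v0; have [vneg|vpos] := ltP v 0; first by rewrite f_neg ?mul0r.
  congr (_ * _); apply: EFin_inj; rewrite -gE unif_angle_in//.
  by rewrite lt_neqAle eq_sym v0.
set X := (\int[PV]_v _)%E in tot *; set Y := (\int[PV]_v _)%E in tot cap.
have X0 : (0 <= X)%E by apply: integral_ge0.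
have Y0 : (0 <= Y)%E by apply: integral_ge0 => v _; rewrite lee_fin.
have Yfin : Y \is a fin_num.
  rewrite ge0_fin_numE//; apply: le_lt_trans (ltry 1); rewrite -tot.
  by rewrite leeDr.
have XE : X = (1 - Y)%E by rewrite -tot addeK.
rewrite XE; move: Yfin; rewrite cap; set Z := (\int[leb]_(_ in _) _)%E => Yfin.
(* The real integral in [lam_thin] is a [fine]; finiteness makes it the true value. *)
have Zfin : Z \is a fin_num by move: Yfin; rewrite fin_numD => /andP[].
rewrite -(fineK Zfin) -EFinD.
have -> : lam_thin lam F f t s u = lam * (1 - (F ((u - s) / t) + fine Z)).
  by rewrite /lam_thin opprD addrA.
by [].
Qed.

Lemma region_measure u r : 0 < u -> 0 <= r ->
  Lam [set m | sqd 0 m < u ^+ 2 \/ sqd t m < r ^+ 2] =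
  (lam * (pi * u ^+ 2) +
   (\int[leb]_(s in `[0, r]%classic) (2 * pi * s * lam_thin lam F f t s u))%R)%:E.
Proof.
move=> u0 r0.
pose A : set Mk := [set m | sqd 0 m < u ^+ 2].
pose B : set Mk := [set m | u ^+ 2 <= sqd 0 m /\ sqd t m < r ^+ 2].
have mA : measurable A by exact: measurable_sqd_lt.
have BE : B = ~` A `&` [set m | sqd t m < r ^+ 2].
  by apply/seteqP; split => m /= [h1 h2]; split => //;
    [apply/negP; rewrite -leNgt|rewrite leNgt; apply/negP].
have mB : measurable B.
  by rewrite BE; apply: measurableI; [apply: measurableC|exact: measurable_sqd_lt].
have -> : [set m : Mk | sqd 0 m < u ^+ 2 \/ sqd t m < r ^+ 2] = A `|` B.
  apply/seteqP; split => m /=; rewrite /A /B/=; last tauto.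
  by case: (ltP (sqd 0 m) (u ^+ 2)) => h; [left|move=> [//|h2]; right].
have AB0 : A `&` B = set0 by apply/seteqP; split => // m [h [h2 _]]; have := lt_le_trans h h2; rewrite ltxx.
have LA : Lam A = (lam * (pi * u ^+ 2))%:E by apply: intensity_disk; exact: ltW.
have Bfin : Lam B \is a fin_num.
  rewrite ge0_fin_numE//; apply: (@le_lt_trans _ _ (Lam [set m | sqd t m < r ^+ 2])).
    apply: le_measure; rewrite ?inE//; first exact: measurable_sqd_lt.
    by move=> m [].
  by rewrite intensity_disk// ltry.
have -> : Lam (A `|` B) = (Lam A + Lam B)%E by apply: measureU.
rewrite LA EFinD; congr (_ + _)%E.
rewrite /Rintegral -[LHS]fineK//; congr (fine _)%:E.
rewrite intensity_annulus//.
have E0 s : (0 <= \int[PV]_v escape t u s v)%E.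
  by apply: integral_ge0 => v _; exact: escape_ge0.
have mE : measurable_fun setT (fun s : mR => \int[PV]_v escape t u s v)%E.
  pose h (vs : mR * mR) := escape t u vs.2 vs.1.
  exact: (@measurable_fun_fubini_tonelli_G _ _ _ _ _ PV h (@measurable_escape R t u) (fun _ => escape_ge0 _ _ _ _)).
have mS : measurable_fun setT (fun s : mR => (shell r s)%:E : \bar R).
  by apply/measurable_EFinP; exact: measurable_shell.
have mh : measurable_fun setT (fun s : mR => ((shell r s)%:E * \int[PV]_v escape t u s v)%E).
  exact: emeasurable_funM.
have h0 s : (0 <= (shell r s)%:E * \int[PV]_v escape t u s v)%E.
  by rewrite mule_ge0// lee_fin shell_ge0.
have lamE0 : (0 <= lam%:E)%E by rewrite lee_fin.
apply: (etrans (esym (@ge0_integralZl _ _ _ leb setT measurableT _ mh _ (fun _ _ => h0 _) lamE0))).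
have key s : 0 < s < r -> (lam%:E * ((shell r s)%:E * \int[PV]_v escape t u s v) =
    (2 * pi * s * lam_thin lam F f t s u)%:E)%E.
  move=> /andP[s0 sr]; rewrite muleCA integral_escape// /shell (ltW s0) sr/=.
  by rewrite EFinM.
(* [integral_escape] excludes [s = 0] and [shell r] vanishes at [r]; the two endpoints are null. *)
rewrite [RHS](@integral_itv_bndoo R 0 r); last first.
  apply: (@eq_measurable_fun _ _ _ _ `]0, r[ (fun s => lam%:E * ((shell r s)%:E * \int[PV]_v escape t u s v))%E).
    by move=> s; rewrite inE/= in_itv/= => /key.
  by apply: measurable_funTS; apply: emeasurable_funM.
rewrite [RHS]integral_mkcond; apply: eq_integral => s _; rewrite patchE mem_setE in_itv/=.
case: ifPn => [/key//|]; rewrite negb_and -!leNgt => h.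
have -> : shell r s = 0; last by rewrite mul0e mule0.
rewrite /shell; case: ifPn => // /andP[s0 sr]; case/orP: h => h.
  have -> : s = 0 by apply/eqP; rewrite eq_le h.
  by rewrite mulr0.
by move: sr; rewrite ltNge h.
Qed.
End region_measure.

(** * The integral in polar coordinates *)

Section final_integral.
Variables (R : realType) (lam : R) (f F : R -> R) (t : R).
Notation leb := (@lebesgue_measure R).
Notation mR := (measurableTypeR R).
Notation Mk := (mR * ((mR * mR) * mR))%type.
Hypotheses (lam0 : 0 <= lam) (f0 : forall x, 0 <= f x) (mf : measurable_fun setT f).
Hypothesis f_neg : forall y, y < 0 -> f y = 0.
Hypothesis f1 : (\int[leb]_x (f x)%:E = 1)%E.
Hypothesis F_cdf : forall x, (F x)%:E = (\int[leb]_(y in `]-oo, x]) (f y)%:E)%E.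
Hypothesis t0 : 0 < t.
Local Notation PV := (pdf_prob f0 mf f1).
Local Notation unif := (@unif_angle R).
Local Notation pl := (@plane R).
Local Notation Lam := (intensity lam0 f0 mf f1).

(** Void probability of a beating region. It takes squared distances, the form in which rotation and
    displacement act. *)
Definition void_prob (a b : R) : R :=
  expR (- fine (Lam [set m : Mk | sqd 0 m < a \/ sqd t m < b])).

Let H (a b : R) : \bar R := (void_prob a b)%:E.

Let H0 a b : (0 <= H a b)%E.
Proof. by rewrite lee_fin expR_ge0. Qed.

Let mH : measurable_fun setT (fun ab : mR * mR => H ab.1 ab.2).
Proof.
pose S : set ((mR * mR) * Mk) := [set w | sqd 0 w.2 < w.1.1 \/ sqd t w.2 < w.1.2].
have m11 : measurable_fun setT (fun w : (mR * mR) * Mk => w.1.1).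
  exact: (measurableT_comp measurable_fst measurable_fst).
have m12 : measurable_fun setT (fun w : (mR * mR) * Mk => w.1.2).
  exact: (measurableT_comp measurable_snd measurable_fst).
have ms s : measurable_fun setT (fun w : (mR * mR) * Mk => sqd s w.2).
  exact: (measurableT_comp (@measurable_sqd R s) measurable_snd).
have mS : measurable S.
  rewrite (_ : S = [set w | sqd 0 w.2 < w.1.1] `|` [set w | sqd t w.2 < w.1.2])//.
  apply: measurableU.
    have := measurable_fun_ltr (ms 0) m11.
    by move=> /(_ measurableT [set true]); rewrite setTI; exact.
  have := measurable_fun_ltr (ms t) m12.
  by move=> /(_ measurableT [set true]); rewrite setTI; exact.
have mX : measurable_fun setT (fun ab : mR * mR => - fine (Lam (xsection S ab))).
  apply: measurable_funN; apply: measurableT_comp => //.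
  exact: (@measurable_fun_xsection _ _ _ _ _ Lam S mS).
have mE : measurable_fun setT (fun ab : mR * mR => expR (- fine (Lam (xsection S ab)))).
  exact: (measurableT_comp (@measurable_expR R) mX).
have -> : (fun ab : mR * mR => H ab.1 ab.2) = fun ab => (expR (- fine (Lam (xsection S ab))))%:E.
  apply/funext => ab; rewrite /H /void_prob; congr (expR (- fine (Lam _)))%:E.
  by apply/seteqP; split => m; rewrite /xsection/= inE.
exact/measurable_EFinP.
Qed.

Let mHa a : measurable_fun setT (fun b : mR => H a b).
Proof.
have mp : measurable_fun setT (fun b : mR => (a, b) : mR * mR) by apply: measurable_fun_pair.
exact: (measurableT_comp mH mp).
Qed.

Let K (v u : R) : \bar R :=
  (\int[unif]_th H (u ^+ 2) (u ^+ 2 + (t * v) ^+ 2 + 2 * u * (t * v) * (- cos th))%R)%E.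

Let K0 v u : (0 <= K v u)%E.
Proof. by apply: integral_ge0. Qed.

Let mK : measurable_fun setT (fun vu : mR * mR => K vu.1 vu.2).
Proof.
pose g (w : (mR * mR) * mR) : \bar R := H (w.1.2 ^+ 2)
  (w.1.2 ^+ 2 + (t * w.1.1) ^+ 2 + 2 * w.1.2 * (t * w.1.1) * (- cos w.2)).
have m1 : measurable_fun setT (fun w : (mR * mR) * mR => w.1.1).
  exact: (measurableT_comp measurable_fst measurable_fst).
have m2 : measurable_fun setT (fun w : (mR * mR) * mR => w.1.2).
  exact: (measurableT_comp measurable_snd measurable_fst).
have m3 : measurable_fun setT (fun w : (mR * mR) * mR => - cos w.2).
  by apply: measurable_funN; exact: (measurableT_comp (@measurable_cos R) measurable_snd).
have mtv : measurable_fun setT (fun w : (mR * mR) * mR => t * w.1.1).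
  exact: measurable_funM.
have mp : measurable_fun setT (fun w : (mR * mR) * mR => (w.1.2 ^+ 2,
   w.1.2 ^+ 2 + (t * w.1.1) ^+ 2 + 2 * w.1.2 * (t * w.1.1) * (- cos w.2)) : mR * mR).
  apply: measurable_fun_pair; first exact: measurable_funX.
  apply: measurable_funD; first by apply: measurable_funD; apply: measurable_funX.
  by apply: measurable_funM => //; apply: measurable_funM => //; exact: measurable_funM.
have mg : measurable_fun setT g by exact: (measurableT_comp mH mp).
exact: (@measurable_fun_fubini_tonelli_F _ _ _ _ _ unif g mg (fun _ => H0 _ _)).
Qed.

Let M (v u : R) : \bar R := ((2 * pi * Num.max u 0)%:E * K v u)%E.

Let M0 v u : (0 <= M v u)%E.
Proof. by rewrite mule_ge0// lee_fin !mulr_ge0 ?pi_ge0// le_max lexx orbT. Qed.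

Let mM : measurable_fun setT (fun vu : mR * mR => M vu.1 vu.2).
Proof.
apply: emeasurable_funM; last exact: mK.
apply/measurable_EFinP; apply: measurable_funM => //.
by apply: measurable_maxr.
Qed.

Let mMv v : measurable_fun setT (fun u : mR => M v u).
Proof.
have mp : measurable_fun setT (fun u : mR => (v, u) : mR * mR) by apply: measurable_fun_pair.
exact: (measurableT_comp mM mp).
Qed.

Let mKv v : measurable_fun setT (fun u : mR => K v u).
Proof.
have mp : measurable_fun setT (fun u : mR => (v, u) : mR * mR) by apply: measurable_fun_pair.
exact: (measurableT_comp mK mp).
Qed.

Let I v : \bar R := (\int[leb]_u M v u)%E.

Let I0 v : (0 <= I v)%E. Proof. by apply: integral_ge0. Qed.

Let mI : measurable_fun setT (I : mR -> \bar R).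
Proof.
exact: (@measurable_fun_fubini_tonelli_F _ _ _ _ _ leb _ mM (fun _ => M0 _ _)).
Qed.

Let I_itv v : (\int[leb]_(u in `[0%R, +oo[) M v u = I v)%E.
Proof.
rewrite integral_mkcond; apply: eq_integral => u _.
rewrite patchE mem_setE in_itv/= andbT; case: ifPn => //; rewrite -ltNge => u0.
by rewrite /M (max_idPr (ltW u0)) mulr0 mul0e.
Qed.

Let fI : \bar R := (\int[leb]_(v in `[0%R, +oo[) ((f v)%:E * I v))%E.

Lemma integral_void_prob :
  (\int[Lam]_m (void_prob (sqd 0 m) (sqd t m))%:E = lam%:E * fI)%E.
Proof.
have mG : measurable_fun setT (fun m : Mk => H (sqd 0 m) (sqd t m)).
  have mp : measurable_fun setT (fun m : Mk => (sqd 0 m, sqd t m) : mR * mR).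
    by apply: measurable_fun_pair; exact: measurable_sqd.
  exact: (measurableT_comp mH mp).
apply: (etrans (ge0_integral_intensity lam0 f0 mf f1 mG (fun _ => H0 _ _))).
apply: (congr1 (fun x => lam%:E * x)%E).
transitivity (\int[PV]_v I v)%E; last first.
  apply: (etrans (ge0_integral_dens leb f0 mf mI I0)).
  rewrite /fI [RHS]integral_mkcond; apply: eq_integral => v _.
  rewrite patchE mem_setE in_itv/= andbT; case: ifPn => //; rewrite -ltNge => v0.
  by rewrite f_neg// mul0e.
apply: eq_integral => v _.
transitivity (\int[pl]_z K v (enorm z))%E.
  apply: eq_integral => z _.
  transitivity (\int[unif]_th H (enorm z ^+ 2)
      ((z.1 + t * v * cos th) ^+ 2 + (z.2 + t * v * sin th) ^+ 2)%R)%E.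
    apply: eq_integral => th _.
    have e0 : sqd 0 (v, (z, th)) = enorm z ^+ 2.
      by rewrite (enorm_sqr z) /sqd/= !mul0r !addr0.
    have et : sqd t (v, (z, th)) = (z.1 + t * v * cos th) ^+ 2 + (z.2 + t * v * sin th) ^+ 2 by [].
    by rewrite e0 et.
  apply: (etrans (ge0_integral_rotate z (t * v) (mHa _) (fun _ => H0 _ _))).
  pose g (c : R) := H (enorm z ^+ 2) (enorm z ^+ 2 + (t * v) ^+ 2 + 2 * enorm z * (t * v) * c).
  have mc : measurable_fun setT (fun c : mR => enorm z ^+ 2 + (t * v) ^+ 2 + 2 * enorm z * (t * v) * c).
    by apply: measurable_funD => //; exact: measurable_funM.
  have mg : measurable_fun setT g by exact: (measurableT_comp (mHa _) mc).
  exact: (ge0_integral_cosN mg (fun _ => H0 _ _)).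
apply: (etrans (ge0_integral_polar (mKv v) (K0 v))).
rewrite -I_itv; apply: eq_integral => u; rewrite inE/= in_itv/= andbT => u0.
by rewrite /M (max_idPl u0).
Qed.

Lemma integral_lb_angle v u : 0 <= v -> 0 <= u ->
  (\int[leb]_(th in `[0%R, (2 * pi)%R]) (lb_integrand lam F f t v u th)%:E =
   (2 * pi * lam * f v)%:E * M v u)%E.
Proof.
(* [region_measure] needs [0 < u]; at [u = 0] both sides vanish through the factor [u]. *)
move=> v0; rewrite le_eqVlt => /predU1P[<-|u0].
  rewrite /M maxxx !mulr0 mul0e mule0; apply: integral0_eq => th _.
  by rewrite /lb_integrand/= !mulr0 !mul0r.
have mth : measurable_fun setT (fun th : mR => H (u ^+ 2) (u ^+ 2 + (t * v) ^+ 2 + 2 * u * (t * v) * (- cos th))%R).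
  have mc : measurable_fun setT (fun th : mR => u ^+ 2 + (t * v) ^+ 2 + 2 * u * (t * v) * (- cos th)).
    apply: measurable_funD => //; apply: measurable_funM => //; apply: measurable_funN.
    exact: measurable_cos.
  exact: (measurableT_comp (mHa _) mc).
have pi0 := pi_gt0 R; have p2 : 2 * pi != 0 :> R by rewrite gt_eqF// mulr_gt0.
have KE : ((2 * pi)%:E * K v u = \int[leb]_(th in `[0%R, (2 * pi)%R])
    H (u ^+ 2)%R (u ^+ 2 + (t * v) ^+ 2 + 2 * u * (t * v) * (- cos th))%R)%E.
  have := integral_uniform (@pi2_gt0 R) mth (fun _ => H0 _ _).
  rewrite subr0 -/(K v u) => ->.
  by rewrite muleA -EFinM mulfV// mul1e.
rewrite /M (max_idPl (ltW u0)).
have -> : ((2 * pi * lam * f v)%:E * ((2 * pi * u)%:E * K v u) =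
    (2 * pi * lam * u * f v)%:E * ((2 * pi)%:E * K v u))%E.
  by rewrite !muleA -!EFinM; congr (_%:E * _)%E; ring.
have c0 : (0 <= (2 * pi * lam * u * f v)%:E :> \bar R)%E.
  by rewrite lee_fin !mulr_ge0// ltW.
rewrite KE; apply: (etrans _ (@ge0_integralZl _ _ _ leb _ (measurable_itv _) _ (measurable_funTS mth) _ (fun _ _ => H0 _ _) c0)).
apply: eq_integral => th _; rewrite -EFinM; congr EFin.
rewrite /lb_integrand/=; set Rr := Num.sqrt _.
have Rr2 : Rr ^+ 2 = u ^+ 2 + (t * v) ^+ 2 + 2 * u * (t * v) * - cos th.
  rewrite sqr_sqrtr; first by ring.
  (* The radicand is [(u - v * t) ^+ 2 + 2 * (1 - cos th) * u * v * t]. *)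
  have := cos_le1 th; have : 0 <= u * v * t by rewrite !mulr_ge0// ltW.
  have := sqr_ge0 (u - v * t); move: (cos th) => c h1 h2 h3.
  have : 0 <= (1 - c) * (u * v * t) by rewrite mulr_ge0//; lra.
  nra.
rewrite /void_prob -Rr2 (region_measure lam0 f0 mf f_neg f1 F_cdf t0 u0 (sqrtr_ge0 _))/=.
rewrite opprD expRD (mulrA lam pi).
ring.
Qed.

Lemma integral_lb : 
  (\int[leb]_(v in `[0%R, +oo[) \int[leb]_(u in `[0%R, +oo[)
     \int[leb]_(th in `[0%R, (2 * pi)%R]) (lb_integrand lam F f t v u th)%:E =
   (2 * pi * lam)%:E * fI)%E.
Proof.
have c0 : (0 <= (2 * pi * lam)%:E :> \bar R)%E by rewrite lee_fin !mulr_ge0// pi_ge0.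
have mfI : measurable_fun setT (fun v : mR => (f v)%:E * I v)%E.
  by apply: emeasurable_funM; [exact/measurable_EFinP|exact: mI].
have fI0 v : (0 <= (f v)%:E * I v)%E by rewrite mule_ge0 ?lee_fin.
apply: (etrans _ (@ge0_integralZl _ _ _ leb _ (measurable_itv _) _ (measurable_funTS mfI) _ (fun _ _ => fI0 _) c0)).
apply: eq_integral => v; rewrite inE/= in_itv/= andbT => v0.
rewrite muleA -EFinM -I_itv.
have c1 : (0 <= (2 * pi * lam * f v)%:E :> \bar R)%E by rewrite lee_fin !mulr_ge0// pi_ge0.
apply: (etrans _ (@ge0_integralZl _ _ _ leb _ (measurable_itv _) _ (measurable_funTS (mMv v)) _ (fun _ _ => M0 _ _) c1)).
apply: eq_integral => u; rewrite inE/= in_itv/= andbT => u0.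
exact: integral_lb_angle.
Qed.

Lemma integral_void_probE :
  (\int[Lam]_m (void_prob (sqd 0 m) (sqd t m))%:E =
   ((2 * pi)^-1)%:E * \int[leb]_(v in `[0%R, +oo[) \int[leb]_(u in `[0%R, +oo[)
     \int[leb]_(th in `[0%R, (2 * pi)%R]) (lb_integrand lam F f t v u th)%:E)%E.
Proof.
have p2 : 2 * pi != 0 :> R by rewrite gt_eqF// pi2_gt0.
by rewrite integral_void_prob integral_lb muleA -EFinM mulrA mulVf// mul1r.
Qed.
End final_integral.

Theorem theorem3 (R : realType) (d : measure_display) (Omega : measurableType d)
  (P : probability Omega R) (h lam0 : R) (FV fV : R -> R)
  (px py v th : nat -> Omega -> R)
  (hh : 0 < h) (hlam0 : 0 < lam0)
  (fV_ge0 : forall y, 0 <= fV y)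
  (fV_neg : forall y, y < 0 -> fV y = 0)
  (fV_meas : measurable_fun setT fV)
  (fV_int1 : (\int[@lebesgue_measure R]_(y in setT) (fV y)%:E = 1)%E)
  (FV_cdf : forall x, (FV x)%:E = (\int[@lebesgue_measure R]_(y in `]-oo, x]) (fV y)%:E)%E)
  (px_meas : forall i, measurable_fun setT (px i))
  (py_meas : forall i, measurable_fun setT (py i))
  (v_meas : forall i, measurable_fun setT (v i))
  (th_meas : forall i, measurable_fun setT (th i))
  (hPPP : marked_PPP px py v th P lam0 FV)
  (t : R) (ht : 0 < t) :
  exists A : set Omega, measurable A /\ A `<=` handover px py v th h t /\
    (handover_lower_bound lam0 FV fV t <= P A)%E.
Proof.
pose Lam := intensity (ltW hlam0) fV_ge0 fV_meas fV_int1.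
pose m i := station px py v th i.
pose N s i := nearest_station px py v th s i.
pose Z s := ~` (\bigcup_i N s i).
have mN s i : measurable (N s i) by exact: measurable_nearest_station.
have mm i : measurable_fun setT (m i) by exact: measurable_station.
have Lbox (B : box R) : box_ok B -> (Lam (box_set B) < +oo)%E.
  by move=> Bok; rewrite /Lam (intensity_box _ _ _ _ FV_cdf Bok) ltry.
have Ldisk s r : (Lam [set m | (sqd s m < r)%R] < +oo)%E.
  (* [intensity_disk] is stated for squares, and this [b] satisfies [r <= b ^+ 2]. *)
  pose b := 1 + `|r|; have b0 : 0 <= b by rewrite addr_ge0.
  have rb : r <= b ^+ 2.
    by have := ler_norm r; have := normr_ge0 r; rewrite /b; nra.
  apply: (@le_lt_trans _ _ (Lam [set m | (sqd s m < b ^+ 2)%R])).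
    apply: le_measure; rewrite ?inE; [exact: measurable_sqd_lt|exact: measurable_sqd_lt|].
    by move=> w /= /lt_le_trans; apply.
  by rewrite /Lam intensity_disk// ltry.
have null s : P (Z s) = 0%E.
  exact: (@negligible_no_nearest _ _ _ _ _ _ _ _ _ _ _ (ltW hlam0) fV_ge0 fV_meas
    fV_int1 FV_cdf px_meas py_meas v_meas th_meas hPPP s (Ldisk s)).
pose E := \bigcup_i (N 0 i `&` N t i).
have mE : measurable E.
  by apply: bigcupT_measurable => i; exact: measurableI.
have keeps_serverE M : keeps_server m t M = \bigcup_i (m i @^-1` (@cube R M) `&` (N 0 i `&` N t i)).
  apply/seteqP; split => w /=.
    move=> [i Mi nb]; exists i => //; split => //.
    by split => j; rewrite leNgt; apply/negP => hlt; apply: (nb j); [left|right].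
  move=> [i _ [Mi [n0 nt]]]; exists i => // j [|]; apply/negP; rewrite -leNgt; [exact: n0|exact: nt].
have mkeeps M : measurable (keeps_server m t M).
  rewrite keeps_serverE; apply: bigcupT_measurable => i; apply: measurableI; last exact: measurableI.
  rewrite -[X in measurable X]setTI; apply: mm => //; exact: measurable_box_set.
have PE : (P E <= \int[Lam]_w (void_prob t (ltW hlam0) fV_ge0 fV_meas fV_int1 (sqd 0 w) (sqd t w))%:E)%E.
  (* The cubes exhaust the marks, so each outcome of [E] lies in [keeps_server m t M] for all large
     [M], while the bound does not depend on [M]. *)
  apply: (@le_measure_approx _ _ _ P (keeps_server m t)) => //.
    move=> w [i _ [n0 nt]].
    have : (\bigcup_M @cube R M) (m i w) by rewrite bigcup_cube.
    move=> [M _ cM]; exists M => // k /= Mk; rewrite keeps_serverE.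
    exists i => //; split => //.
    rewrite -(subnK Mk); elim: (k - M)%N => //= p ih; rewrite addSn.
    exact: cubeS.
  move=> M; apply: (@le_keeps_server _ _ R P m Lam).
  - exact: mm.
  - by move=> n c; apply: Lbox; exact: grid_box_ok.
  - by move=> n A; exact: P_no_station_in.
  - have hM : - M.+1%:R <= M.+1%:R :> R by have := ler0n R M.+1; lra.
    by apply: Lbox; do ![split].
  - exact: mkeeps.
pose A := \bigcup_i \bigcup_(j in [set j | j != i]) (N 0 i `&` N t j).
have mA : measurable A.
  apply: bigcupT_measurable => i; apply: bigcup_measurable => j _; exact: measurableI.
exists A; split => //; split.
  move=> w [i _ [j /= ji [n0 nt]]]; exists 0; split; first by rewrite lexx ht.
  exists i, j; split; first exact/nearestE.
  split; first exact/nearestE.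
  by move=> ij; rewrite ij eqxx in ji.
(* Ties are harmless: [A] and [E] may overlap, since only this covering is used. *)
have AC : ~` A `<=` (Z 0 `|` Z t) `|` E.
  move=> w nA.
  have [[i _ n0]|n0] := pselect ((\bigcup_i N 0 i) w); last by left; left.
  have [[j _ nt]|nt] := pselect ((\bigcup_i N t i) w); last by left; right.
  right; have [ji|ji] := eqVneq j i; first by exists i => //; split => //; rewrite -ji.
  by exfalso; apply: nA; exists i => //; exists j.
have mNs s : measurable (Z s).
  by apply: measurableC; apply: bigcupT_measurable.
have PAC : (P (~` A) <= P E)%E.
  apply: (@le_trans _ _ (P ((Z 0 `|` Z t) `|` E))).
    apply: le_measure; rewrite ?inE//; first exact: measurableC.
    by apply: measurableU => //; exact: measurableU.
  apply: (le_trans (measureU2 _ _ _)) => //; first exact: measurableU.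
  rewrite -[leRHS]add0e leeD//.
  apply: (le_trans (measureU2 _ _ _)) => //.
  have h0 : (P (Z 0%R) + P (Z t) <= 0)%E by rewrite !null adde0.
  exact: h0.
have PA : P A = (1 - P (~` A))%E by rewrite -[in LHS](setCK A) probability_setC//; exact: measurableC.
rewrite PA /handover_lower_bound leeB//.
apply: (le_trans PAC); apply: (le_trans PE).
by rewrite (integral_void_probE (ltW hlam0) fV_ge0 fV_meas fV_neg fV_int1 FV_cdf ht).
Qed.
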